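(* There exist a uniformly discrete sequence of real numbers $\Lambda=\{\lambda_n\}$ and a function $g\in L^2(\mathbb{R})$ such that the system of translates $\{g(t-\lambda)\}_{\lambda\in\Lambda}$ is a $(QF)$-system for $L^2(\mathbb{R})$.
   Context: A set (sequence) $\Lambda$ of real numbers is uniformly discrete if $\inf_{\lambda\neq\lambda',\ \lambda,\lambda'\in\Lambda}|\lambda-\lambda'|>0$. A system of vectors $\{u_n\}$ in a Hilbert space $H$ is called a $(QF)$-system if the following two conditions hold: (i) for every $q>2$ there is a constant $C(q)$ such that, for every $f\in H$ and every $\epsilon>0$, there is a (finite) linear combination $Q=\sum c_n u_n$ with $\|f-Q\|<\epsilon$ and $\|\{c_n\}\|_{l_q}\le C(q)\|f\|$; (ii) (Bessel inequality) there is a constant $C'$, not depending on $f$, such that $\left(\sum|\langle f,u_n\rangle|^2\right)^{1/2}\le C'\|f\|$ for all $f\in H$. *)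

(* Defs.v *)
From mathcomp Require Import all_boot all_order all_algebra.
From mathcomp Require Import all_classical all_reals all_analysis.
From mathcomp Require Export complex.

Set Implicit Arguments.
Unset Strict Implicit.
Unset Printing Implicit Defensive.

Import Order.TTheory GRing.Theory Num.Theory.
Import Normc.
Import numFieldNormedType.Exports.

Local Open Scope classical_set_scope.
Local Open Scope ring_scope.
Local Open Scope complex_scope.

(* The infimum is taken in the extended reals, so that it is +oo when
   L has at most one point. *)
Definition uniformly_discrete (R : realType) (L : set R) : Prop :=
  (0 < ereal_inf [set z | exists x y, [/\ L x, L y, x != y &
                                          z = `|x - y|%:E]])%E.

Section QFSystem.
Context {R : realType} {V : lmodType R[i]}.

(* The Hilbert space is given by a linear subspace H of V and an inner product
   dot on H, linear in its first argument; vectors at distance 0 are not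
   identified, which does not affect the notions below. *)
Context (H : set V) (dot : V -> V -> R[i]).

Definition dot_norm (f : V) : R := Num.sqrt (complex.Re (dot f f)).

Definition lq_norm (q : R) (N : nat) (c : 'I_N -> R[i]) : R :=
  (\sum_(n < N) normc (c n) `^ q) `^ q^-1.

Definition QF_approximation (u : nat -> V) : Prop :=
  forall q : R, 2 < q -> exists C : R,
    forall f, H f -> forall eps : R, 0 < eps ->
      exists (N : nat) (c : 'I_N -> R[i]),
        dot_norm (f - \sum_(n < N) c n *: u n) < eps /\
        lq_norm q c <= C * dot_norm f.

Definition Bessel (u : nat -> V) : Prop :=
  exists C : R, forall f, H f ->
    (sqrte (\sum_(0 <= n <oo) (normc (dot f (u n)) ^+ 2)%:E)
       <= (C * dot_norm f)%:E)%E.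

Definition QF_system (u : nat -> V) : Prop :=
  [/\ forall n, H (u n), QF_approximation u & Bessel u].

End QFSystem.

Section L2.
Context {R : realType}.

(* R[i]^o makes the functions an R[i]-module: R[i] itself is canonically a
   module over R. *)
Implicit Types f g : R -> R[i]^o.

(* Borel measurable representatives, not quotiented by equality almost
   everywhere. *)
Definition L2 : set (R -> R[i]^o) := [set f : R -> R[i]^o |
  [/\ measurable_fun [set: R] (fun t : R => complex.Re (f t)),
      measurable_fun [set: R] (fun t : R => complex.Im (f t)) &
      finite_norm (@lebesgue_measure R) 2%:E
        (fun t : R => normc (f t))]].

Definition complex_integral f : R[i] :=
  (\int[@lebesgue_measure R]_(t in [set: R]) complex.Re (f t)) +i*
  (\int[@lebesgue_measure R]_(t in [set: R]) complex.Im (f t)).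

Definition L2dot f g : R[i] := complex_integral (fun t => f t * conjc (g t)).

Definition translate (a : R) (g : R -> R[i]^o) : R -> R[i]^o :=
  fun t => g (t - a).

End L2.

(* Main.v *)
Require Import Defs.
From mathcomp Require Import all_boot all_order all_algebra.
From mathcomp Require Import all_classical all_reals all_analysis.
From mathcomp Require Import measurable_realfun.
From mathcomp Require Import ring lra zify.

Set Implicit Arguments.
Unset Strict Implicit.
Unset Printing Implicit Defensive.

Import Order.TTheory GRing.Theory Num.Theory.
Import numFieldNormedType.Exports.

Local Open Scope classical_set_scope.
Local Open Scope ring_scope.

(**
Let e be the indicator of ]0, 1] and let T be the unit translation. The generator
is g = (prod_k B_k) e, where each B_k is essentially 1 / (1 + R_k) and R_k is a
Riesz product in a power T^N of T, N = N_k: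
  R_k = prod_j (1 + a cos_j)^2 / (1 + a^2/2),   cos_j = (T^(5^j N) + T^(-5^j N)) / 2,
with m factors. It has mean 1, and when a -> 0 with m a^2 = K fixed, its other
coefficients are at most a while their l_2 norm stays bounded, so that their l_q
norm tends to 0 for every q > 2. On the other hand R_k = W^2 with W positive of mean
(1 + a^2/2)^(-m/2), which is small for large K; hence
|R_k (1 + R_k)^-1 e|^2 <= <W e, e> is small, i.e., B_k e is close to e and R_k g is
close to 0. As R_k has mean 1, g is approximated by a combination of its translates
by the nonzero frequencies of R_k, with coefficients small in l_q. Shifting by a
rational s gives T^s g. Far apart stages k, in which every s occurs infinitely often,
keep the translations uniformly discrete.

The Bessel inequality holds because the B_k are self-adjoint contractions commuting
with translations, and translates of e by 1-separated reals are orthonormal. Since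
each B_k is invertible, e lies in the closed span of the translates of g, and the
averages of 1_]0,s] - 1_]n,n+s], which are combinations of translates of e, converge
to 1_]0,s]; so this span is dense.
*)

(** * Square-integrable real functions *)

Section RealL2.
Context {R : realType}.
Implicit Types (f g h : R -> R) (a b c : R).

Notation mu := (@lebesgue_measure R).

Definition square_integrable f : Prop := f \in Lfun mu 2%:E.

Definition ip f g : R := \int[mu]_x (f x * g x).

Definition shift a f : R -> R := fun x => f (x - a).

Lemma square_integrableP f : square_integrable f <->
  measurable_fun [set: R] f /\ mu.-integrable setT (EFin \o (fun x => f x ^+ 2)).
Proof.
split=> [fL|[mf /integrableP[_ fi]]].
  split; last exact: Lfun2_integrable_sqr.
  by move: fL => /andP[]; rewrite inE.
apply/andP; split; rewrite inE//= /finite_norm unlock /=.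
apply: poweR_lty.
move: fi; apply: le_lt_trans; rewrite le_eqVlt; apply/orP; left; apply/eqP.
apply: eq_integral => x _ /=.
by rewrite powR_mulrn// normrX.
Qed.

Lemma square_integrable_measurable f :
  square_integrable f -> measurable_fun [set: R] f.
Proof. by case/square_integrableP. Qed.

Lemma square_integrableM f g : square_integrable f -> square_integrable g ->
  mu.-integrable setT (EFin \o (fun x => f x * g x)).
Proof. by move=> fL gL; apply/Lfun1_integrable; exact: Lfun2_mul_Lfun1. Qed.

Lemma square_integrableD f g : square_integrable f -> square_integrable g ->
  square_integrable (f + g).
Proof.
by move=> fL gL; have /= := (@Lfun_addr_closed _ _ _ mu 2%:E _).2 _ _ fL gL; apply; rewrite lee1n.
Qed.

Lemma square_integrableZ c f : square_integrable f -> square_integrable (c *: f).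
Proof.
move=> fL.
have -> : c *: f = c \o* f by apply/funext => x; rewrite !fctE /= mulrC.
by apply: Lfun_scale => //; rewrite ler1n.
Qed.

Lemma square_integrable0 : square_integrable 0.
Proof.
by have /= := (@Lfun_addr_closed _ _ _ mu 2%:E _).1; apply; rewrite lee1n.
Qed.


Lemma square_integrableN f : square_integrable f -> square_integrable (- f).
Proof. by move=> fL; rewrite -scaleN1r; exact: square_integrableZ. Qed.

Lemma square_integrableB f g : square_integrable f -> square_integrable g ->
  square_integrable (f - g).
Proof. by move=> fL gL; apply: square_integrableD => //; exact: square_integrableN. Qed.

Lemma square_integrable_sum (I : Type) (r : seq I) (P : pred I) (F : I -> R -> R) :
  (forall i, P i -> square_integrable (F i)) ->
  square_integrable (\sum_(i <- r | P i) F i).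
Proof.
by move=> FL; apply: big_ind => //; [exact: square_integrable0|exact: square_integrableD].
Qed.

(** Lebesgue measure is the only measure giving each interval []b, c]] its length, and the
    pushforward does so too. *)
Lemma pushforward_lebesgue_shift a (A : set R) : measurable A ->
  pushforward mu (fun x : measurableTypeR R => x - a : measurableTypeR R) A = mu A.
Proof.
have ma : measurable_fun [set: measurableTypeR R]
    (fun x : measurableTypeR R => x - a : measurableTypeR R).
  exact: measurable_funB.
move=> mA; apply/esym.
pose nu : {measure set (measurableTypeR R) -> \bar R} :=
  measure_function_pushforward__canonical__measure_function_Measure mu ma.
apply: (@lebesgue_measure_unique _ nu) => //= _ [[b c]] _ <-.
rewrite /nu /pushforward /=.
rewrite (_ : _ @^-1` _ = `]b + a, c + a]%classic); last first.
  by apply/seteqP; split => x /=; rewrite !in_itv/= ltrBrDr lerBlDr.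
rewrite !lebesgue_measure_itv/= !lte_fin ltrD2r.
by case: ifPn => // _; rewrite -!EFinB opprD addrACA subrr addr0.
Qed.

Lemma measurable_shift a f :
  measurable_fun [set: R] f -> measurable_fun [set: R] (shift a f).
Proof.
by move=> mf; apply: (measurableT_comp mf); exact: measurable_funB.
Qed.

Lemma ge0_integral_shift a f : measurable_fun [set: R] f -> (forall x, 0 <= f x) ->
  (\int[mu]_x (shift a f x)%:E = \int[mu]_x (f x)%:E)%E.
Proof.
move=> mf f0.
have ma : measurable_fun [set: measurableTypeR R]
    (fun x : measurableTypeR R => x - a : measurableTypeR R).
  exact: measurable_funB.
transitivity (\int[pushforward mu (fun x : measurableTypeR R =>
    (x - a)%R : measurableTypeR R)]_x (f x)%:E)%E.
  rewrite (@ge0_integral_pushforward _ _ _ _ _ _ ma mu setT (EFin \o f))//.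
    exact/measurable_EFinP.
  by move=> x _; rewrite lee_fin.
by apply: eq_measure_integral => A mA _; exact: pushforward_lebesgue_shift.
Qed.

Lemma square_integrable_shift a f :
  square_integrable f -> square_integrable (shift a f).
Proof.
move=> /square_integrableP[mf /integrableP[mf2 fi]]; apply/square_integrableP.
split; first exact: measurable_shift.
have msf : measurable_fun [set: R] (fun x => f x ^+ 2) by exact: measurable_funX.
apply/integrableP; split.
  by apply/measurable_EFinP; exact: (measurable_shift a msf).
have absE (h : R -> R) : (\int[mu]_x `|(EFin \o (fun x => h x ^+ 2)%R) x| =
    \int[mu]_x (h x ^+ 2)%:E)%E.
  by apply: eq_integral => x _; rewrite gee0_abs// lee_fin sqr_ge0.
by move: fi; rewrite !absE (ge0_integral_shift a msf)// => x; exact: sqr_ge0.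
Qed.

Lemma ip_shift a f g : square_integrable f -> square_integrable g ->
  ip (shift a f) (shift a g) = ip f g.
Proof.
move=> fL gL; rewrite /ip /Rintegral; congr fine.
have ma : measurable_fun [set: measurableTypeR R]
    (fun x : measurableTypeR R => x - a : measurableTypeR R).
  exact: measurable_funB.
transitivity (\int[pushforward mu (fun x : measurableTypeR R =>
    (x - a)%R : measurableTypeR R)]_x (f x * g x)%R%:E)%E.
  rewrite (@integral_pushforward _ _ _ _ _ _ ma mu setT
      (EFin \o (fun x => f x * g x)))//.
    apply/measurable_EFinP; apply: measurable_funM; exact: square_integrable_measurable.
  exact: (square_integrableM (square_integrable_shift a fL) (square_integrable_shift a gL)).
by apply: eq_measure_integral => A mA _; exact: pushforward_lebesgue_shift.
Qed.

Lemma ipC f g : ip f g = ip g f.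
Proof. by apply: eq_Rintegral => x _; rewrite mulrC. Qed.

Lemma ipDl f g h : square_integrable f -> square_integrable g ->
  square_integrable h -> ip (f + g) h = ip f h + ip g h.
Proof.
move=> fL gL hL; rewrite /ip -RintegralD//; try exact: square_integrableM.
by apply: eq_Rintegral => x _; rewrite fctE mulrDl.
Qed.

Lemma ipZl c f h : square_integrable f -> square_integrable h ->
  ip (c *: f) h = c * ip f h.
Proof.
move=> fL hL; rewrite /ip -RintegralZl//; last exact: square_integrableM.
by apply: eq_Rintegral => x _; rewrite fctE mulrA.
Qed.

Lemma ipDr f g h : square_integrable f -> square_integrable g ->
  square_integrable h -> ip h (f + g) = ip h f + ip h g.
Proof. by move=> *; rewrite ipC ipDl// !(ipC _ h). Qed.

Lemma ipZr c f h : square_integrable f -> square_integrable h ->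
  ip h (c *: f) = c * ip h f.
Proof. by move=> *; rewrite ipC ipZl// ipC. Qed.

Lemma ipNl f h : square_integrable f -> square_integrable h ->
  ip (- f) h = - ip f h.
Proof. by move=> *; rewrite -scaleN1r ipZl// mulN1r. Qed.

Lemma ipNr f h : square_integrable f -> square_integrable h ->
  ip h (- f) = - ip h f.
Proof. by move=> *; rewrite ipC ipNl// ipC. Qed.

Lemma ip0l f : ip 0 f = 0.
Proof.
rewrite /ip (@eq_Rintegral _ _ _ mu setT (cst 0)) ?Rintegral_cst ?mul0r//.
by move=> x _; rewrite fctE mul0r.
Qed.

Lemma ip_suml (I : Type) (r : seq I) (P : pred I) (F : I -> R -> R) h :
  (forall i, P i -> square_integrable (F i)) -> square_integrable h ->
  ip (\sum_(i <- r | P i) F i) h = \sum_(i <- r | P i) ip (F i) h.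
Proof.
move=> FL hL; elim: r => [|i r IH]; first by rewrite !big_nil ip0l.
rewrite !big_cons; case: ifPn => // Pi; rewrite ipDl ?IH//; first exact: FL.
exact: square_integrable_sum.
Qed.

Lemma ip_sumr (I : Type) (r : seq I) (P : pred I) (F : I -> R -> R) h :
  (forall i, P i -> square_integrable (F i)) -> square_integrable h ->
  ip h (\sum_(i <- r | P i) F i) = \sum_(i <- r | P i) ip h (F i).
Proof.
by move=> FL hL; rewrite ipC ip_suml//; apply: eq_bigr => i _; rewrite ipC.
Qed.

Lemma ip_ge0 f : 0 <= ip f f.
Proof. by apply: Rintegral_ge0 => x _; rewrite -expr2 sqr_ge0. Qed.

Lemma ipBB f g : square_integrable f -> square_integrable g ->
  ip (f - g) (f - g) = ip f f - 2 * ip f g + ip g g.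
Proof.
move=> fL gL; have NgL := square_integrableN gL.
by rewrite ipDl ?ipDr ?ipNl ?ipNr// ?(ipC g f); [ring|exact: square_integrableB].
Qed.

Lemma ipDD f g : square_integrable f -> square_integrable g ->
  ip (f + g) (f + g) = ip f f + 2 * ip f g + ip g g.
Proof.
move=> fL gL; rewrite ipDl ?ipDr// ?(ipC g f); [ring|exact: square_integrableD].
Qed.

(** The discriminant argument for the nonnegative polynomial [ip (f - t *: g) (f - t *: g)] in
    [t]. *)
Lemma cauchy_schwarz f g : square_integrable f -> square_integrable g ->
  ip f g ^+ 2 <= ip f f * ip g g.
Proof.
move=> fL gL.
have quad t : 0 <= ip f f - 2 * t * ip f g + t ^+ 2 * ip g g.
  have := ip_ge0 (f - t *: g).
  have tgL := square_integrableZ t gL.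
  by rewrite ipBB// ipZr// ipZl// ipZr// expr2 !mulrA.
have [C0|C0] := eqVneq (ip g g) 0.
  have [->|B0] := eqVneq (ip f g) 0; first by rewrite C0 mulr0 expr0n.
  (* With [ip g g = 0] the polynomial is affine, and this [t] gives it the value -1. *)
  have := quad ((ip f f + 1) / (2 * ip f g)).
  rewrite C0 mulr0 addr0 (_ : 2 * _ * _ = ip f f + 1); last by field.
  by rewrite opprD addrA subrr add0r oppr_ge0 ler10.
have Cp : 0 < ip g g by rewrite lt_neqAle eq_sym C0 ip_ge0.
have := quad (ip f g / ip g g).
rewrite (_ : _ + _ = (ip f f * ip g g - ip f g ^+ 2) / ip g g); last by field.
by rewrite pmulr_lge0 ?invr_gt0// subr_ge0.
Qed.

Definition nrm f : R := Num.sqrt (ip f f).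

Lemma nrm_ge0 f : 0 <= nrm f. Proof. exact: sqrtr_ge0. Qed.

Lemma sqr_nrm f : nrm f ^+ 2 = ip f f. Proof. by rewrite sqr_sqrtr ?ip_ge0. Qed.

Lemma normr_ip_le f g : square_integrable f -> square_integrable g ->
  `|ip f g| <= nrm f * nrm g.
Proof.
move=> fL gL; rewrite -(@ler_pXn2r _ 2)// ?nnegrE ?mulr_ge0 ?nrm_ge0//.
by rewrite exprMn !sqr_nrm real_normK ?num_real// cauchy_schwarz.
Qed.

Lemma nrm_le f c : 0 <= c -> (nrm f <= c) = (ip f f <= c ^+ 2).
Proof. by move=> c0; rewrite -sqr_nrm ler_pXn2r// nnegrE ?nrm_ge0. Qed.

Lemma nrm_leq f g : (nrm f <= nrm g) = (ip f f <= ip g g).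
Proof. by rewrite nrm_le ?nrm_ge0// sqr_nrm. Qed.

Lemma nrmD f g : square_integrable f -> square_integrable g ->
  nrm (f + g) <= nrm f + nrm g.
Proof.
move=> fL gL; rewrite nrm_le ?addr_ge0 ?nrm_ge0// ipDD// sqrrD !sqr_nrm.
have := le_trans (ler_norm _) (normr_ip_le fL gL); lra.
Qed.

Lemma nrmZ c f : square_integrable f -> nrm (c *: f) = `|c| * nrm f.
Proof.
move=> fL; rewrite /nrm ipZl ?ipZr//; last exact: square_integrableZ.
by rewrite mulrA -expr2 sqrtrM ?sqr_ge0// sqrtr_sqr.
Qed.

Lemma nrmN f : square_integrable f -> nrm (- f) = nrm f.
Proof. by move=> fL; rewrite -scaleN1r nrmZ// normrN normr1 mul1r. Qed.

Lemma nrmB f g : square_integrable f -> square_integrable g ->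
  nrm (f - g) <= nrm f + nrm g.
Proof.
by move=> fL gL; rewrite -(nrmN gL); apply: nrmD => //; exact: square_integrableN.
Qed.

Lemma nrm0 : nrm 0 = 0. Proof. by rewrite /nrm ip0l sqrtr0. Qed.

Lemma nrm_shift a f : square_integrable f -> nrm (shift a f) = nrm f.
Proof. by move=> fL; rewrite /nrm ip_shift. Qed.

Lemma nrm_dist_le f g h : square_integrable f -> square_integrable g ->
  square_integrable h -> nrm (f - h) <= nrm (f - g) + nrm (g - h).
Proof.
move=> fL gL hL; rewrite -[f - h](subrKA g).
by apply: nrmD; exact: square_integrableB.
Qed.

Lemma nrm_distC f g : square_integrable f -> square_integrable g ->
  nrm (f - g) = nrm (g - f).
Proof. by move=> fL gL; rewrite -nrmN ?opprB//; exact: square_integrableB. Qed.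

(** For the orthogonal projection [P] of [f], [ip (f - P) (f - P)] is [ip f f - S], and it is
    nonnegative. *)
Lemma bessel_orthonormal (N : nat) (u : nat -> R -> R) f :
  square_integrable f -> (forall n, square_integrable (u n)) ->
  (forall i j, ip (u i) (u j) = (i == j)%:R) ->
  \sum_(n < N) ip f (u n) ^+ 2 <= ip f f.
Proof.
move=> fL uL uo; set S := \sum_(n < N) _.
have cuL n : square_integrable (ip f (u n) *: u n) by exact: square_integrableZ.
pose P : R -> R := \sum_(n < N) ip f (u n) *: u n.
have PL : square_integrable P by exact: square_integrable_sum.
have fP : ip f P = S.
  rewrite ip_sumr//; apply: eq_bigr => i _; rewrite ipZr// expr2//.
have PP : ip P P = S.
  rewrite {1}/P ip_suml//; apply: eq_bigr => i _; rewrite ipZl//.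
  rewrite ip_sumr// (bigD1 i)//= big1 ?addr0 => [|j ji].
    by rewrite ipZr// uo eqxx mulr1 expr2.
  by rewrite ipZr// uo eq_sym -val_eqE/= in ji *; rewrite (negbTE ji) mulr0.
by have := ip_ge0 (f - P); rewrite ipBB// fP PP; lra.
Qed.

End RealL2.

(** * Step functions *)

Section Steps.
Context {R : realType}.
Implicit Types (f g h : R -> R) (a b c : R).

Notation mu := (@lebesgue_measure R).

Lemma square_integrable_indic (A : set R) :
  measurable A -> (mu A < +oo)%E -> square_integrable (\1_A : R -> R).
Proof.
move=> mA Aoo; apply/square_integrableP; split; first exact: measurable_indic.
have -> : (fun x => (\1_A x : R) ^+ 2) = \1_A.
  by apply/funext => x; rewrite indicE; case: (_ \in _); rewrite ?expr1n ?expr0n.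
apply/integrableP; split.
  by apply/measurable_EFinP; exact: measurable_indic.
under eq_integral do rewrite gee0_abs ?lee_fin ?indic_ge0//.
by rewrite integral_indic// setIT.
Qed.

Lemma ip_indic (A B : set R) : measurable A -> measurable B ->
  ip (\1_A : R -> R) \1_B = fine (mu (A `&` B)).
Proof.
move=> mA mB; rewrite /ip /Rintegral; congr fine.
rewrite -[in RHS](setIT (A `&` B)) -integral_indic//; last exact: measurableI.
by apply: eq_integral => x _; rewrite indicI.
Qed.

Definition itvoc a b : R -> R := \1_(`]a, b]%classic).

Lemma itvocE a b x : itvoc a b x = (a < x <= b)%R%:R.
Proof. by rewrite /itvoc indicE mem_setE in_itv. Qed.

Lemma square_integrable_itvoc a b : square_integrable (itvoc a b).
Proof.
apply: square_integrable_indic => //.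
by rewrite lebesgue_measure_itv /=; case: ifPn => // _; rewrite -EFinB ltry.
Qed.

Lemma shift_itvoc c a b : shift c (itvoc a b) = itvoc (a + c) (b + c).
Proof.
by apply/funext => x; rewrite /shift !itvocE ltrBrDr lerBlDr.
Qed.

Lemma ip_itvoc_diag a b : a <= b -> ip (itvoc a b) (itvoc a b) = b - a.
Proof.
move=> ab; rewrite /itvoc ip_indic// setIid lebesgue_measure_itv /= lte_fin.
by case: ltP => //= ba; apply/eqP; rewrite eq_sym subr_eq0 eq_le ab ba.
Qed.

Lemma ip_itvoc_disjoint a b c d : b <= c -> ip (itvoc a b) (itvoc c d) = 0.
Proof.
move=> bc; rewrite /itvoc ip_indic// (_ : _ `&` _ = set0) ?measure0//.
apply/seteqP; split => // x [] /=; rewrite !in_itv/= => /andP[_ xb] /andP[cx _].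
by move: (lt_le_trans cx xb); rewrite ltNge bc.
Qed.

Lemma nrm_itvoc a b : a <= b -> nrm (itvoc a b) = Num.sqrt (b - a).
Proof. by move=> ab; rewrite /nrm ip_itvoc_diag. Qed.

Definition unit_itv : R -> R := itvoc 0 1.

Lemma square_integrable_unit_itv : square_integrable unit_itv.
Proof. exact: square_integrable_itvoc. Qed.

Lemma ip_unit_itv : ip unit_itv unit_itv = 1.
Proof. by rewrite ip_itvoc_diag// subr0. Qed.

Lemma nrm_unit_itv : nrm unit_itv = 1.
Proof. by rewrite /nrm ip_unit_itv sqrtr1. Qed.

Lemma ip_shift_unit_itv a b : 1 <= `|a - b| ->
  ip (shift a unit_itv) (shift b unit_itv) = 0.
Proof.
rewrite /unit_itv !shift_itvoc !add0r.
have [ab|ba] := leP a b => d.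
  apply: ip_itvoc_disjoint; move: d.
  by rewrite distrC ger0_norm ?subr_ge0//; lra.
rewrite ipC; apply: ip_itvoc_disjoint; move: d.
by rewrite gtr0_norm ?subr_gt0//; lra.
Qed.

(** That is, constancy on every []n - 1, n]]. For such functions the norm controls each value, so
    that Cauchy sequences converge at every point and identities hold pointwise, not only almost
    everywhere. *)
Definition step_fun f := forall t, f t = f (Num.ceil t)%:~R.

(** The unit interval []n - 1, n]] containing [t] alone contributes [f t ^+ 2] to [ip f f]. *)
Lemma normr_step_fun_le f t : square_integrable f -> step_fun f ->
  `|f t| <= nrm f.
Proof.
move=> fL fs; rewrite -(@ler_pXn2r _ 2)// ?nnegrE ?nrm_ge0//.
rewrite sqr_nrm real_normK ?num_real//.
set n : R := (Num.ceil t)%:~R.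
pose A := `]n - 1, n]%classic.
have AL : square_integrable (\1_A : R -> R) by exact: square_integrable_itvoc.
have A1 : ip (\1_A : R -> R) \1_A = 1.
  by have := @ip_itvoc_diag (n - 1) n; rewrite /itvoc => ->; lra.
have -> : f t ^+ 2 = ip (f t *: \1_A) (f t *: \1_A).
  by rewrite ipZl ?ipZr// ?A1 ?mulr1 ?expr2//; exact: square_integrableZ.
apply: le_Rintegral => //.
- by apply: square_integrableM; exact: square_integrableZ.
- exact: square_integrableM.
move=> x _; rewrite fctE indicE.
have [|_] := boolP (x \in A); last by rewrite scaler0 mul0r -expr2 sqr_ge0.
rewrite inE /A /= in_itv/= => xn.
have -> : f t = f x.
  rewrite (fs t) (fs x); congr (f _%:~R); apply/esym/ceil_def.
  by rewrite intrB.
by rewrite /GRing.scale/= mulr1.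
Qed.

(** Fatou's lemma for the squares. *)
Lemma square_integrable_fatou (f_ : nat -> R -> R) f c : 0 <= c ->
  (forall n, square_integrable (f_ n)) ->
  (forall t, f_ n t @[n --> \oo] --> f t) ->
  (\forall n \near \oo, nrm (f_ n) <= c) -> square_integrable f /\ nrm f <= c.
Proof.
move=> c0 fL cf [N _ fc].
have mf : measurable_fun [set: R] f.
  apply: (@measurable_fun_cvg _ _ _ _ f_) => //.
  by move=> n; exact: square_integrable_measurable.
have mf2 : measurable_fun [set: R] (fun x => f x ^+ 2) by exact: measurable_funX.
have le : (\int[mu]_x (f x ^+ 2)%:E <= (c ^+ 2)%:E)%E.
  have -> : (\int[mu]_x (f x ^+ 2)%:E =
      \int[mu]_x limn_einf (fun n => (f_ n x ^+ 2)%:E))%E.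
    apply: eq_integral => x _; apply/esym.
    apply: (cvg_limn_einf_sup _).1; apply: cvg_EFin; first exact: nearW.
    by apply: (@cvg_comp _ _ _ (f_ ^~ x) (fun y : R => y ^+ 2) _ _ _ (cf x));
      exact: exprn_continuous.
  apply: le_trans; first apply: fatou => //.
  - move=> n; apply/measurable_EFinP; apply: measurable_funX.
    exact: square_integrable_measurable.
  - by move=> n x _; rewrite lee_fin sqr_ge0.
  rewrite limn_einf_lim; apply: lime_le; first exact: is_cvg_einfs.
  exists N => // n /= Nn.
  apply: (@le_trans _ _ (\int[mu]_x (f_ n x ^+ 2)%:E)%E).
    by apply: ereal_inf_lbound; exists n => /=.
  have /square_integrableP[_ fi] := fL n.
  rewrite -(fineK (integrable_fin_num _ fi))// lee_fin.
  by have := fc n Nn; rewrite nrm_le//.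
have fL' : square_integrable f.
  apply/square_integrableP; split => //; apply/integrableP; split.
    exact/measurable_EFinP.
  under eq_integral do rewrite gee0_abs ?lee_fin ?sqr_ge0//.
  by rewrite (le_lt_trans le)// ltry.
split=> //; rewrite nrm_le//.
have /square_integrableP[_ fi] := fL'.
rewrite -lee_fin; apply: le_trans le; rewrite /ip /Rintegral fineK//.
by apply: (integrable_fin_num _ fi).
Qed.

(** The values are Cauchy by [normr_step_fun_le], which gives a pointwise limit; Fatou's lemma for
    [f_ j - f_ n], as [j] grows, makes it a limit in norm with the same rate [tau]. *)
Lemma step_fun_limit (f_ : nat -> R -> R) (tau : nat -> R) :
  (forall n, square_integrable (f_ n)) -> (forall n, step_fun (f_ n)) ->
  (forall i j, (i <= j)%N -> nrm (f_ j - f_ i) <= tau i) ->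
  tau @ \oo --> 0 ->
  exists f, [/\ square_integrable f, step_fun f,
    forall t, f_ n t @[n --> \oo] --> f t &
    forall n, nrm (f - f_ n) <= tau n].
Proof.
move=> fL fs ftau tau0.
have cf t : cvg (f_ n t @[n --> \oo]).
  apply: cauchy_cvg; apply: cauchy_exP => e e0.
  have [N _ Ne] : \forall n \near \oo, tau n < e.
    by move/cvgr_lt : tau0; apply.
  exists (f_ N t); exists N => // j /= Nj; rewrite /ball/= distrC.
  apply: le_lt_trans (Ne N (leqnn N)); apply: le_trans (ftau _ _ Nj).
  apply: (@normr_step_fun_le (f_ j - f_ N) t); first exact: square_integrableB.
  by move=> s; rewrite !fctE (fs j s) (fs N s).
pose f t := lim (f_ n t @[n --> \oo]).
have cff t : f_ n t @[n --> \oo] --> f t by exact: cf.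
have close n : square_integrable (f - f_ n) /\ nrm (f - f_ n) <= tau n.
  apply: (@square_integrable_fatou (fun j => f_ j - f_ n)).
  - by apply: le_trans (ftau n n (leqnn n)); exact: nrm_ge0.
  - by move=> j; exact: square_integrableB.
  - by move=> t; apply: cvgB => //; exact: cvg_cst.
  - by exists n => // j /= nj; exact: ftau.
exists f; split => //.
- by rewrite -[f](subrK (f_ 0%N)); apply: square_integrableD => //; case: (close 0%N).
- move=> t; rewrite /f; have -> // : f_ ^~ t = f_ ^~ (Num.ceil t)%:~R.
  by apply/funext => n; exact: fs.
- by move=> n; case: (close n).
Qed.

End Steps.

(** * Even convolution operators *)

Section Operators.
Context {R : realType}.
Implicit Types (f g h : R -> R) (a b c : R) (A B : (R -> R) -> R -> R).

Lemma shift_lin a c f g : shift a (c *: f + g) = c *: shift a f + shift a g.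
Proof. by []. Qed.

Lemma shiftD a f g : shift a (f + g) = shift a f + shift a g.
Proof. by []. Qed.

Lemma shiftZ a c f : shift a (c *: f) = c *: shift a f.
Proof. by []. Qed.

Lemma shift_sum a (I : Type) (r : seq I) (P : pred I) (F : I -> R -> R) :
  shift a (\sum_(i <- r | P i) F i) = \sum_(i <- r | P i) shift a (F i).
Proof. by apply: (big_morph (shift a)). Qed.

Lemma shift_shift a b f : shift a (shift b f) = shift (a + b) f.
Proof. by apply/funext => x; rewrite /shift opprD addrA. Qed.

Lemma shift0 f : shift 0 f = f.
Proof. by apply/funext => x; rewrite /shift subr0. Qed.

(* On the Fourier side these are the multipliers given by even trigonometric
   polynomials of period 1. *)
Inductive even_op : ((R -> R) -> R -> R) -> Prop :=
| even_op_scale c : even_op (fun f => c *: f)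
| even_op_cos (n : nat) : even_op (fun f => shift n%:R f + shift (- n%:R) f)
| even_op_add A B : even_op A -> even_op B -> even_op (fun f => A f + B f)
| even_op_comp A B : even_op A -> even_op B -> even_op (fun f => A (B f)).

Lemma even_op_id : even_op id.
Proof.
have -> : id = (fun f : R -> R => 1 *: f) by apply/funext => f; rewrite scale1r.
exact: even_op_scale.
Qed.

Lemma even_op_lin A : even_op A ->
  forall c f g, A (c *: f + g) = c *: A f + A g.
Proof.
elim=> {A} [d|n|A B _ IA _ IB|A B _ IA _ IB] c f g.
- by rewrite scalerDr !scalerA mulrC.
- by rewrite !shift_lin scalerDr addrACA.
- by rewrite IA IB scalerDr addrACA.
- by rewrite IB IA.
Qed.

Lemma even_opD A : even_op A -> {morph A : f g / f + g}.
Proof. by move=> opA f g; have := even_op_lin opA 1 f g; rewrite !scale1r. Qed.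

Lemma even_op0 A : even_op A -> A 0 = 0.
Proof.
by move=> opA; have := even_op_lin opA (-1) 0 0; rewrite !scaleN1r oppr0 addr0 addNr.
Qed.

Lemma even_opZ A : even_op A -> forall c f, A (c *: f) = c *: A f.
Proof.
by move=> opA c f; have := even_op_lin opA c f 0; rewrite (even_op0 opA) !addr0.
Qed.

Lemma even_opN A : even_op A -> {morph A : f / - f}.
Proof. by move=> opA f; rewrite -scaleN1r (even_opZ opA) scaleN1r. Qed.

Lemma even_opB A : even_op A -> {morph A : f g / f - g}.
Proof. by move=> opA f g; rewrite even_opD// even_opN. Qed.

Lemma even_op_square_integrable A : even_op A ->
  forall f, square_integrable f -> square_integrable (A f).
Proof.
elim=> {A} [d|n|A B _ IA _ IB|A B _ IA _ IB] f fL.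
- exact: square_integrableZ.
- by apply: square_integrableD; exact: square_integrable_shift.
- by apply: square_integrableD; [exact: IA|exact: IB].
- exact/IA/IB.
Qed.

Lemma even_op_shift A : even_op A -> forall a f, A (shift a f) = shift a (A f).
Proof.
elim=> {A} [d|n|A B _ IA _ IB|A B _ IA _ IB] a f.
- by [].
- by rewrite !shift_shift shiftD !shift_shift ![a + _]addrC.
- by rewrite IA IB.
- by rewrite IB IA.
Qed.

Lemma even_op_commute A B : even_op A -> even_op B -> forall f, A (B f) = B (A f).
Proof.
move=> opA; elim=> {B} [d|n|B C _ IB _ IC|B C _ IB _ IC] f.
- exact: even_opZ.
- by rewrite (even_opD opA) !(even_op_shift opA).
- by rewrite (even_opD opA) IB IC.
- by rewrite IB IC.
Qed.

Lemma ip_shift_adj a f g : square_integrable f -> square_integrable g ->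
  ip (shift a f) g = ip f (shift (- a) g).
Proof.
move=> fL gL; rewrite -(ip_shift (- a))//; last exact: square_integrable_shift.
by rewrite shift_shift addNr shift0.
Qed.

(** The adjoint of a shift is the opposite shift, so the sum of the two is self-adjoint; a
    composition is self-adjoint because its factors commute. *)
Lemma even_op_selfadjoint A : even_op A -> forall f g,
  square_integrable f -> square_integrable g -> ip (A f) g = ip f (A g).
Proof.
elim=> {A} [d|n|A B opA IA opB IB|A B opA IA opB IB] f g fL gL.
- by rewrite ipZl// ipZr.
- have := square_integrable_shift.
  by move=> sL; rewrite ipDl ?ipDr; auto; rewrite !ip_shift_adj// opprK addrC.
- by rewrite ipDl ?ipDr ?IA ?IB//; exact: even_op_square_integrable.
- by rewrite IA ?IB ?(even_op_commute opB opA)//; exact: even_op_square_integrable.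
Qed.

Lemma even_op_bounded A : even_op A -> exists2 M, 0 <= M &
  forall f, square_integrable f -> nrm (A f) <= M * nrm f.
Proof.
elim=> {A} [d|n|A B opA [M M0 IA] opB [M' M'0 IB]|A B opA [M M0 IA] opB [M' M'0 IB]].
- by exists `|d| => // f fL; rewrite nrmZ.
- exists 2 => // f fL; rewrite mulrDl !mul1r.
  apply: le_trans (nrmD _ _) _; try exact: square_integrable_shift.
  by rewrite !nrm_shift.
- exists (M + M'); first exact: addr_ge0.
  move=> f fL; rewrite mulrDl; apply: le_trans (nrmD _ _) _;
    try exact: even_op_square_integrable.
  by apply: lerD; [exact: IA|exact: IB].
- exists (M * M'); first exact: mulr_ge0.
  move=> f fL; apply: le_trans (IA _ _) _; first exact: even_op_square_integrable.
  by rewrite -mulrA ler_wpM2l// IB.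
Qed.

Lemma step_fun_shift (n : int) f : step_fun f -> step_fun (shift n%:~R f).
Proof.
move=> fs t; rewrite /shift fs -intrB; congr (f _%:~R).
have /andP[lt_ct le_tc] := ceil_itv t.
by apply: ceil_def; move: lt_ct le_tc; rewrite !intrB => *; apply/andP; split; lra.
Qed.

Lemma even_op_step_fun A : even_op A -> forall f, step_fun f -> step_fun (A f).
Proof.
elim=> {A} [d|n|A B opA IA opB IB|A B opA IA opB IB] f fs t.
- by rewrite !fctE fs.
- rewrite !fctE; have := @step_fun_shift n f fs t; rewrite -!pmulrn => ->.
  by have := @step_fun_shift (- n%:Z) f fs t; rewrite mulrNz -!pmulrn => ->.
- by rewrite !fctE (IA f fs t) (IB f fs t).
- exact: IA (IB f fs) t.
Qed.

Lemma even_op_pointwise A : even_op A -> forall (f_ : nat -> R -> R) f,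
  (forall t, f_ n t @[n --> \oo] --> f t) ->
  forall t, A (f_ n) t @[n --> \oo] --> A f t.
Proof.
elim=> {A} [d|n|A B opA IA opB IB|A B opA IA opB IB] f_ f ff t.
- by apply: cvgMr => //; exact: cvg_cst.
- by apply: cvgD; exact: ff.
- by apply: cvgD; [exact: IA|exact: IB].
- by apply: IA => s; exact: IB.
Qed.

Lemma even_op_stable (Y : set (R -> R)) A : even_op A ->
  (forall f g, Y f -> Y g -> Y (f + g)) -> (forall c f, Y f -> Y (c *: f)) ->
  (forall (n : int) f, Y f -> Y (shift n%:~R f)) ->
  forall f, Y f -> Y (A f).
Proof.
move=> + YD YZ Ys.
elim=> {A} [d|n|A B opA IA opB IB|A B opA IA opB IB] f Yf.
- exact: YZ.
- apply: YD; first by have := Ys n f Yf; rewrite -pmulrn.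
  by have := Ys (- n%:Z) f Yf; rewrite mulrNz -pmulrn.
- by apply: YD; [exact: IA|exact: IB].
- exact/IA/IB.
Qed.

End Operators.

(** * Riesz products *)

Section RieszProducts.
Context {R : realType}.
Implicit Types (f g h : R -> R) (a b c : R) (gam : nat -> R) (m n N : nat).

(** The index [i] stands for the frequency [i - 2], so that [gam 2] is the mean. *)
Definition pentanomial gam N f : R -> R :=
  \sum_(i < 5) gam i *: shift ((i%:R - 2) * N%:R) f.

(* The factors have the frequencies N, 5N, 25N, ..., so that the frequencies of
   the product are given by balanced base 5 expansions and never collide. *)
Fixpoint riesz gam m N f : R -> R :=
  if m is m'.+1 then riesz gam m' (5 * N) (pentanomial gam N f) else f.

(** For [n < 5 ^ m], the product of [gam] over the [m] digits of [n] in base 5. It belongs to the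
    frequency [n - center m]: subtracting [center m] lowers each digit by 2. *)
Fixpoint riesz_coef gam m n : R :=
  if m is m'.+1 then gam (n %% 5)%N * riesz_coef gam m' (n %/ 5) else (n == 0)%:R.

(* The number with [m] digits 2 in base 5. *)
Fixpoint center m : nat := if m is m'.+1 then (5 * center m' + 2)%N else 0%N.

Lemma centerE m : (2 * center m + 1 = 5 ^ m)%N.
Proof. by elim: m => //= m IH; rewrite expnS -IH; lia. Qed.

Lemma big_ord_mul5 (V : nmodType) m (F : nat -> V) :
  \sum_(k < 5 * m) F k = \sum_(n < m) \sum_(i < 5) F (5 * n + i)%N.
Proof.
elim: m => [|m IH]; first by rewrite muln0 !big_ord0.
have -> : (5 * m.+1 = 5 * m + 5)%N by lia.
by rewrite big_split_ord [RHS]big_ord_recr [X in X + _ = _]IH.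
Qed.

Lemma divn_digit n (i : 'I_5) : ((5 * n + i) %/ 5 = n)%N.
Proof. by rewrite mulnC divnMDl// divn_small ?addn0. Qed.

Lemma modn_digit n (i : 'I_5) : ((5 * n + i) %% 5 = i)%N.
Proof. by rewrite mulnC modnMDl modn_small. Qed.

(** In an index [5 n + i], the digit [i] comes from the factor in powers of the shift by [N], and
    [n] from the remaining factors, in powers of the shift by [5 N]. *)
Lemma rieszE gam m N f : riesz gam m N f =
  \sum_(n < 5 ^ m) riesz_coef gam m n *: shift ((n%:R - (center m)%:R) * N%:R) f.
Proof.
elim: m N f => [|m IH] N f /=.
  by rewrite big_ord1 /= subrr mul0r shift0 scale1r.
rewrite IH expnS (big_ord_mul5 (5 ^ m)%N (fun n => (gam (n %% 5)%N *
  riesz_coef gam m (n %/ 5)) *: shift ((n%:R - (5 * center m + 2)%:R) * N%:R) f)).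
apply: eq_bigr => n _; rewrite shift_sum scaler_sumr; apply: eq_bigr => i _.
rewrite divn_digit modn_digit shiftZ shift_shift scalerA [_ * gam i]mulrC.
congr (_ *: _); congr (shift _ f); rewrite !(natrM, natrD); ring.
Qed.

Lemma pentanomialE gam N f : gam 0%N = gam 4%N -> gam 1%N = gam 3%N ->
  pentanomial gam N f = gam 2%N *: f
    + gam 1%N *: (shift N%:R f + shift (- N%:R) f)
    + gam 0%N *: (shift (2 * N)%:R f + shift (- (2 * N)%:R) f).
Proof.
move=> g04 g13; rewrite /pentanomial !big_ord_recl big_ord0 /= addr0.
rewrite /bump/= -!g04 -!g13.
apply/funext => x; rewrite !fctE /shift /GRing.scale/= natrM.
have -> : x - (2%:R - 2) * N%:R = x by ring.
have -> : x - (0 - 2) * N%:R = x - - (2 * N%:R) by ring.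
have -> : x - (1 - 2) * N%:R = x - - N%:R by ring.
have -> : x - (3 - 2) * N%:R = x - N%:R by ring.
have -> : x - (4 - 2) * N%:R = x - (2 * N%:R) by ring.
ring.
Qed.

Lemma even_op_pentanomial gam N : gam 0%N = gam 4%N -> gam 1%N = gam 3%N ->
  even_op (pentanomial gam N).
Proof.
move=> g04 g13.
have -> : pentanomial gam N = (fun f => gam 2%N *: f
    + gam 1%N *: (shift N%:R f + shift (- N%:R) f)
    + gam 0%N *: (shift (2 * N)%:R f + shift (- (2 * N)%:R) f)).
  by apply/funext => f; exact: pentanomialE.
apply: even_op_add; first apply: even_op_add; first exact: even_op_scale.
  exact: (even_op_comp (even_op_scale _) (even_op_cos N)).
exact: (even_op_comp (even_op_scale _) (even_op_cos (2 * N))).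
Qed.

Lemma even_op_riesz gam m N : gam 0%N = gam 4%N -> gam 1%N = gam 3%N ->
  even_op (riesz gam m N).
Proof.
move=> g04 g13; elim: m N => [|m IH] N /=; first exact: even_op_id.
apply: even_op_comp; [exact: IH|exact: even_op_pentanomial].
Qed.

Lemma riesz_coef_center gam m : gam 2%N = 1 -> riesz_coef gam m (center m) = 1.
Proof.
move=> g2; elim: m => [|m IH] //=.
have -> : ((5 * center m + 2) %% 5 = 2)%N by lia.
have -> : ((5 * center m + 2) %/ 5 = center m)%N by lia.
by rewrite IH g2 mulr1.
Qed.

(** An index below [5 ^ m] other than [center m] has a digit other than 2, whose factor is at most
    [a], while the other factors are at most 1. From [5 ^ m] on the coefficient is 0. *)
Lemma riesz_coef_bound gam a m n : gam 2%N = 1 -> 0 <= a <= 1 ->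
  (forall i, (i < 5)%N -> 0 <= gam i) ->
  (forall i, (i < 5)%N -> i != 2%N -> gam i <= a) ->
  (0 <= riesz_coef gam m n <= 1) /\ (n != center m -> riesz_coef gam m n <= a).
Proof.
move=> g2 /andP[a0 a1] gge0 gle.
have g1 i : (i < 5)%N -> gam i <= 1.
  by move=> i5; have [->|i2] := eqVneq i 2%N; [rewrite g2|apply: le_trans (gle i _ _) _].
elim: m n => [|m IH] n /=.
  by case: n => [|n] /=; split; rewrite ?lexx ?ler01.
have i5 : (n %% 5 < 5)%N by rewrite ltn_mod.
have [/andP[c0 c1] ca] := IH (n %/ 5)%N; split.
  by rewrite mulr_ge0 ?gge0//= mulr_ile1// ?gge0 ?g1.
move=> nc; have [n2|n2] := eqVneq (n %% 5)%N 2%N.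
  rewrite n2 g2 mul1r; apply: ca; apply: contra nc => /eqP <-.
  by rewrite {1}(divn_eq n 5) n2 mulnC.
apply: le_trans (gle _ i5 n2).
by rewrite ler_piMr// gge0.
Qed.

(** Summing over each digit separately turns the sum of products into a product of sums. *)
Lemma sum_sqr_riesz_coef gam m :
  \sum_(n < 5 ^ m) riesz_coef gam m n ^+ 2 = (\sum_(i < 5) gam i ^+ 2) ^+ m.
Proof.
elim: m => [|m IH]; first by rewrite big_ord1 expr1n.
rewrite expnS exprSr -IH.
rewrite (big_ord_mul5 (5 ^ m)%N (fun n => riesz_coef gam m.+1 n ^+ 2)).
rewrite big_distrl/=; apply: eq_bigr => n _; rewrite big_distrr/=.
by apply: eq_bigr => i _; rewrite divn_digit modn_digit exprMn mulrC.
Qed.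

Lemma normr_natB_ge1 m n : m != n -> 1 <= `|m%:R - n%:R : R|.
Proof.
move=> mn; have -> : m%:R - n%:R = (m%:Z - n%:Z)%:~R :> R by rewrite intrB -!pmulrn.
by rewrite -intr_norm -[1]/(1%:~R) ler_int -gtz0_ge1 normr_gt0 subr_eq0.
Qed.

(** Distinct frequencies differ by at least 1, so the translates of [unit_itv] are orthogonal and
    only the coefficient of frequency 0, which is 1, remains. *)
Lemma ip_riesz_unit_itv gam m N : gam 2%N = 1 -> (0 < N)%N ->
  ip (riesz gam m N unit_itv) unit_itv = 1.
Proof.
move=> g2 N0; have eL := @square_integrable_unit_itv R.
rewrite rieszE ip_suml//; last first.
  by move=> i _; apply: square_integrableZ; exact: square_integrable_shift.
have cm : (center m < 5 ^ m)%N by rewrite -centerE; lia.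
rewrite (bigD1 (Ordinal cm))//= subrr mul0r shift0.
rewrite riesz_coef_center// scale1r ip_unit_itv big1 ?addr0// => i ic.
rewrite ipZl//; last exact: square_integrable_shift.
rewrite -{2}(shift0 unit_itv) ip_shift_unit_itv ?mulr0// subr0.
rewrite normrM normr_nat.
have d1 : 1 <= `|i%:R - (center m)%:R : R|.
  by apply: normr_natB_ge1; move: ic; rewrite -val_eqE.
by apply: le_trans d1 _; rewrite ler_peMr// ler1n.
Qed.

End RieszProducts.

(** * Inverting 1 + W^2 *)

Section Regularization.
Context {R : realType}.
Implicit Types (f g h x y : R -> R) (a b c : R) (A B E W : (R -> R) -> R -> R).

Local Notation SI := square_integrable.
Local Notation e := (@unit_itv R).

Definition nonneg_op W := forall f, SI f -> 0 <= ip (W f) f.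

(** These subspaces express the invertibility of the operators [B] below: if [B y] lies in [Y], then
    so does [y]. *)
Definition closed_invariant (Y : set (R -> R)) : Prop :=
  [/\ forall f, Y f -> SI f,
      forall f g, Y f -> Y g -> Y (f + g),
      forall c f, Y f -> Y (c *: f),
      forall (n : int) f, Y f -> Y (shift n%:~R f) &
      forall f, SI f ->
        (forall eps, 0 < eps -> exists2 g, Y g & nrm (f - g) <= eps) -> Y f].

Lemma even_op_sub A B : even_op A -> even_op B -> even_op (fun f => A f - B f).
Proof.
move=> opA opB.
have -> : (fun f : R -> R => A f - B f) = (fun f => A f + (-1) *: B f).
  by apply/funext => f; rewrite scaleN1r.
apply: even_op_add => //; exact: (even_op_comp (even_op_scale _) opB).
Qed.

Lemma even_op_iter A n : even_op A -> even_op (iter n A).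
Proof.
move=> opA; elim: n => [|n IH]; first exact: even_op_id.
exact: (even_op_comp opA IH).
Qed.

Lemma nrm_iter_le A c n f : 0 <= c -> even_op A -> SI f ->
  (forall g, SI g -> nrm (A g) <= c * nrm g) -> nrm (iter n A f) <= c ^+ n * nrm f.
Proof.
move=> c0 opA fL Ac; elim: n => [|n IH]; first by rewrite mul1r.
rewrite iterS exprS -mulrA; apply: le_trans (Ac _ _) _.
  by apply: even_op_square_integrable => //; exact: even_op_iter.
by rewrite ler_wpM2l.
Qed.

Lemma exprn_small c eps : 0 <= c < 1 -> 0 < eps -> exists n, c ^+ n <= eps.
Proof.
move=> /andP[c0 c1] eps0.
have : (fun n => c ^+ n) @ \oo --> (0 : R) by apply: cvg_expr; rewrite ger0_norm.
move/cvgr_le => /(_ _ eps0)[n _ /(_ n (leqnn n))/= cn].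
by exists n.
Qed.

(* The contraction [E0 = 1 - tau (1 + W^2)] drives a truncated Neumann series. *)
Lemma approximate_resolvent W eta : even_op W -> 0 < eta ->
  exists B E, [/\ even_op B, even_op E,
    forall f, B f + W (W (B f)) = f - E f &
    forall f, SI f -> nrm (E f) <= eta * nrm f].
Proof.
move=> opW eta0; have [M M0 WM] := even_op_bounded opW.
(* Since [0 <= W^2 <= M^2], the operator [tau (1 + W^2)] lies between [tau] and 1, so that [E0] has
   norm at most [1 - tau]. *)
pose tau := (1 + M ^+ 2)^-1.
have s0 : 0 < 1 + M ^+ 2 by rewrite ltr_pwDl// sqr_ge0.
have tau0 : 0 < tau by rewrite invr_gt0.
have tauM : tau * M ^+ 2 = 1 - tau by rewrite /tau; field; rewrite gt_eqF.
have tau1 : 0 <= 1 - tau by rewrite -tauM mulr_ge0 ?sqr_ge0// ltW.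
have WL := even_op_square_integrable opW.
pose E0 f := (1 - tau) *: f - tau *: W (W f).
have opE0 : even_op E0.
  apply: even_op_sub; first exact: even_op_scale.
  exact: (even_op_comp (even_op_scale _) (even_op_comp opW opW)).
have E0c f : SI f -> nrm (E0 f) <= (1 - tau) * nrm f.
  move=> fL; rewrite nrm_le ?mulr_ge0 ?nrm_ge0// exprMn sqr_nrm.
  have WfL := WL _ fL; have WWfL := WL _ WfL.
  rewrite ipBB ?ipZl ?ipZr//; try exact: square_integrableZ.
  rewrite (even_op_selfadjoint opW)// -/(ip _ _).
  have -> : ip f (W (W f)) = ip (W f) (W f) by rewrite -(even_op_selfadjoint opW).
  have WW : ip (W f) (W (W (W f))) <= M ^+ 2 * ip (W f) (W f).
    rewrite -(even_op_selfadjoint opW)//.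
    have := WM _ WfL; rewrite nrm_le; last by rewrite mulr_ge0 ?nrm_ge0.
    by rewrite exprMn sqr_nrm.
  have q0 := ip_ge0 (W f).
  have : tau * (tau * ip (W f) (W (W (W f)))) <= tau * ((1 - tau) * ip (W f) (W f)).
    rewrite ler_pM2l// -tauM -mulrA ler_pM2l//.
  have : 0 <= (1 - tau) * (tau * ip (W f) (W f)) by rewrite !mulr_ge0// ltW.
  lra.
(* [Bt t] is [tau] times the sum of the first [t] powers of [E0]. The zero operator is written as a
   scaling to make it an [even_op]. *)
pose Bt := fix Bt t f := if t is t'.+1 then tau *: f + E0 (Bt t' f) else 0 *: f.
have opBt t : even_op (Bt t).
  elim: t => [|t IH]; first exact: even_op_scale.
  apply: even_op_add; [exact: even_op_scale|exact: (even_op_comp opE0 IH)].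
have BtE t f : Bt t f + W (W (Bt t f)) = f - iter t E0 f.
  elim: t => [|t IH] /=.
    by rewrite scale0r !(even_op0 opW) subrr addr0.
  have -> : E0 (iter t E0 f) = E0 f - E0 (Bt t f + W (W (Bt t f))).
    by rewrite IH -(even_opB opE0) subKr.
  have opWW := even_op_comp opW opW.
  rewrite (even_opD opWW (tau *: f)) (even_opZ opWW) -(even_op_commute opE0 opWW).
  rewrite (even_opD opE0) /E0; apply/funext => s.
  rewrite !fctE /GRing.scale/=; ring.
have [t tE] : exists t, (1 - tau) ^+ t <= eta.
  by apply: exprn_small => //; rewrite tau1/= gtrBl.
exists (Bt t), (iter t E0); split => //; first exact: even_op_iter.
move=> f fL; apply: le_trans (nrm_iter_le _ tau1 opE0 fL E0c) _.
by rewrite ler_wpM2r// nrm_ge0.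
Qed.

(* On the spectral side: [w^4 <= w (1 + w^2)^2] for [w >= 0]. *)
Lemma ip_square_le_resolvent W x : even_op W -> nonneg_op W -> SI x ->
  ip (W (W x)) (W (W x)) <= ip (W (x + W (W x))) (x + W (W x)).
Proof.
move=> opW W0 xL; have WL := even_op_square_integrable opW.
have WxL := WL _ xL; have W2L := WL _ WxL; have W3L := WL _ W2L; have W4L := WL _ W3L.
have mu1 := W0 _ xL; have mu3 := W0 _ WxL.
(* In terms of the moments m_k = <W^k x, x>, this says m_5 - 2 m_4 + m_3 >= 0, and the goal is m_4
   <= m_1 + 2 m_3 + m_5. *)
have pos := W0 _ (square_integrableB W2L WxL).
have e1 : ip (W (W (W x))) (W x) = ip (W (W x)) (W (W x)).
  by rewrite (even_op_selfadjoint opW).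
have e2 : ip (W (W (W x))) x = ip (W (W x)) (W x) by rewrite (even_op_selfadjoint opW).
move: pos mu1 mu3 e1 e2; rewrite (even_opB opW) (even_opD opW).
move: (W x) (W (W x)) (W (W (W x))) WxL W2L W3L => p q r pL qL rL.
have -> : ip (r - q) (q - p) = ip r q - ip r p - ip q q + ip q p.
  rewrite ipDl//; last exact: square_integrableB; last exact: square_integrableN.
  rewrite !ipDr//; try exact: square_integrableN.
  by rewrite !ipNl ?ipNr//; [ring|exact: square_integrableN].
have -> : ip (p + r) (x + q) = ip p x + ip q p + ip r x + ip r q.
  rewrite ipDl//; last exact: square_integrableD.
  by rewrite !ipDr// (ipC p q); ring.
have := ip_ge0 q; lra.
Qed.

(** [B] is an approximate inverse of [1 + W^2], scaled to a contraction. Up to small errors,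
    [W (W (B e))] is [e - B e] and has squared norm at most [ip (W e) e]. *)
Lemma regularization W del : even_op W -> nonneg_op W -> 0 < del ->
  ip (W e) e <= del ^+ 2 / 8 ->
  exists B, [/\ even_op B, forall f, SI f -> nrm (B f) <= nrm f,
    nrm (B e - e) <= del, nrm (W (W (B e))) <= del &
    forall Y, closed_invariant Y -> forall y, SI y -> Y (B y) -> Y y].
Proof.
move=> opW W0 del0 rhoP; have [M M0 WM] := even_op_bounded opW.
have eL := @square_integrable_unit_itv R.
(* The bound by 1/2 makes the powers of [E] tend to 0, [del / 4] serves the distance from [B e] to
   [e], and the last bound absorbs three errors of size [M * eta] in
   [ip (W (e - E e)) (e - E e)]. *)
have [eta [eta0 eta2 eta4 etaM]] : exists eta,
    [/\ 0 < eta, eta <= 2^-1, eta <= del / 4 & 3 * M * eta <= del ^+ 2 / 8].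
  pose c := del ^+ 2 / (24 * (M + 1)).
  have M1 : 0 < M + 1 by rewrite ltr_wpDl.
  have c0 : 0 < c by rewrite divr_gt0 ?exprn_gt0 ?mulr_gt0.
  exists (Num.min (2^-1) (Num.min (del / 4) c)); split.
  - by rewrite !lt_min invr_gt0 ltr0n divr_gt0.
  - by rewrite ge_min lexx.
  - by rewrite !ge_min lexx orbT.
  - apply: (@le_trans _ _ (3 * M * c)).
      by rewrite ler_wpM2l ?mulr_ge0// !ge_min lexx !orbT.
    have -> : 3 * M * c = del ^+ 2 / 8 * (M / (M + 1)).
      by rewrite /c; field; rewrite gt_eqF.
    by rewrite ler_piMr ?divr_ge0 ?sqr_ge0// ler_pdivrMr// mul1r lerDl.
have [B [E [opB opE BE Ec]]] := approximate_resolvent opW eta0.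
have BL := even_op_square_integrable opB; have EL := even_op_square_integrable opE.
have WL := even_op_square_integrable opW.
have eta1 : 0 < 1 + eta by rewrite addr_gt0.
(* As [1 + W^2 >= 1], the norm of [B f] is at most that of [B f + W (W (B f)) = f - E f]. *)
have BEc f : SI f -> nrm (B f) <= (1 + eta) * nrm f.
  move=> fL; apply: (@le_trans _ _ (nrm (f - E f))); last first.
    rewrite mulrDl mul1r; apply: le_trans (nrmB fL (EL _ fL)) _.
    by rewrite lerD2l Ec.
  have WBL := WL _ (WL _ (BL _ fL)).
  rewrite -BE nrm_leq ipDD//; last exact: BL.
  rewrite -(even_op_selfadjoint opW)//; [|exact: BL|exact/WL/BL].
  have := ip_ge0 (W (B f)); have := ip_ge0 (W (W (B f))); lra.
set x := B e; have xL : SI x by exact: BL.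
have WWxL : SI (W (W x)) by exact/WL/WL.
have Ee : nrm (E e) <= eta by have := Ec _ eL; rewrite nrm_unit_itv mulr1.
have EeL := EL _ eL.
have WWx : nrm (W (W x)) <= del / 2.
  rewrite nrm_le; last by rewrite divr_ge0// ltW.
  apply: le_trans (ip_square_le_resolvent opW W0 xL) _.
  have WeL := WL _ eL; have WEeL := WL _ EeL.
  rewrite BE (even_opB opW).
  have -> : ip (W e - W (E e)) (e - E e) =
      ip (W e) e - ip (W e) (E e) - ip (W (E e)) e + ip (W (E e)) (E e).
    rewrite ipDl//; [|exact: square_integrableN|exact: square_integrableB].
    rewrite !ipDr//; try exact: square_integrableN.
    by rewrite !ipNl ?ipNr//; [ring|exact: square_integrableN].
  have WEe : nrm (W (E e)) <= M * eta.
    by apply: le_trans (WM _ EeL) _; rewrite ler_wpM2l.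
  have h1 : `|ip (W (E e)) e| <= M * eta.
    apply: le_trans (normr_ip_le (WL _ EeL) eL) _.
    by rewrite nrm_unit_itv mulr1.
  have h2 : `|ip (W (E e)) (E e)| <= M * eta.
    apply: le_trans (normr_ip_le (WL _ EeL) EeL) _.
    rewrite -[leRHS]mulr1 ler_pM ?nrm_ge0//.
    by apply: le_trans Ee _; apply: le_trans eta2 _; lra.
  have -> : ip (W e) (E e) = ip (W (E e)) e by rewrite (even_op_selfadjoint opW)// ipC.
  move: h1 h2; rewrite !ler_norml => /andP[h1 h1'] /andP[h2 h2'].
  have -> : (del / 2) ^+ 2 = del ^+ 2 / 4 by field.
  lra.
exists (fun f => (1 + eta)^-1 *: B f).
have i0 : 0 <= (1 + eta)^-1 by rewrite invr_ge0 ltW.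
have i1 : (1 + eta)^-1 <= 1 by rewrite invf_le1// lerDl ltW.
split.
- exact: (even_op_comp (even_op_scale _) opB).
- move=> f fL; rewrite nrmZ; last exact: BL.
  by rewrite ger0_norm// mulrC ler_pdivrMr// mulrC BEc.
- have -> : (1 + eta)^-1 *: B e - e = (1 + eta)^-1 *: (- W (W x) - E e - eta *: e).
    have -> : - W (W x) - E e = x - e.
      by rewrite -[e in RHS](subrK (E e)) -BE -/x; apply/funext => t;
        rewrite !fctE; ring.
    have -> : x - e - eta *: e = x - (1 + eta) *: e.
      by rewrite scalerDl scale1r opprD addrA.
    by rewrite scalerBr scalerA mulVf ?scale1r// gt_eqF.
  have NL := square_integrableN WWxL; have eeL := square_integrableZ eta eL.
  have dL := square_integrableB NL EeL.
  rewrite nrmZ; last exact: square_integrableB.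
  rewrite ger0_norm//; apply: (@le_trans _ _ (nrm (- W (W x) - E e - eta *: e))).
    by rewrite ler_piMl// nrm_ge0.
  apply: le_trans (nrmB dL eeL) _.
  have := nrmB NL EeL; rewrite nrmN// (nrmZ _ eL) nrm_unit_itv mulr1 gtr0_norm//.
  lra.
- rewrite !(even_opZ opW) nrmZ// ger0_norm//.
  apply: (@le_trans _ _ (nrm (W (W x)))); first by rewrite ler_piMl// nrm_ge0.
  by apply: le_trans WWx _; lra.
move=> Y [YL YD YZ Ys Yc] y yL YBy.
have Yop A f : even_op A -> Y f -> Y (A f) by move=> opA; exact: (even_op_stable opA YD YZ Ys).
have YB : Y (B y).
  have := YZ (1 + eta) _ YBy; rewrite scalerA divff ?scale1r// gt_eqF//.
(* Here [y - E y] is [1 + W^2] applied to [B y]. By telescoping, [y - iter n E y] lies in [Y] as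
   well, and it tends to [y]. *)
have YyE : Y (y - E y) by rewrite -BE; apply: (YD _ _ YB); exact/Yop/Yop.
have YyEn n : Y (y - iter n E y).
  elim: n => [|n IH] /=; first by rewrite subrr -(scale0r (y - E y)); exact: YZ.
  have -> : y - E (iter n E y) = (y - E y) + E (y - iter n E y).
    by rewrite (even_opB opE) addrA subrK.
  by apply: YD => //; exact: Yop.
apply: Yc => // eps eps0.
have n0 : 0 < nrm y + 1 by rewrite ltr_wpDl ?nrm_ge0.
have [|n En] := @exprn_small eta (eps / (nrm y + 1)) _ (divr_gt0 eps0 n0).
  by rewrite ltW//= (le_lt_trans eta2)// invf_lt1// ltr1n.
exists (y - iter n E y) => //; rewrite subKr.
apply: le_trans (nrm_iter_le n (ltW eta0) opE yL Ec) _.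
apply: (@le_trans _ _ (eps / (nrm y + 1) * nrm y)).
  by rewrite ler_wpM2r// nrm_ge0.
by rewrite -mulrA ler_piMr ?(ltW eps0)// mulrC ler_pdivrMr// mul1r lerDl.
Qed.

End Regularization.

(** * One stage of the construction: approximation with small coefficients *)

Section ApproximationStep.
Context {R : realType}.
Implicit Types (f g : R -> R) (a b c q : R) (m n N : nat).

Local Notation SI := square_integrable.
Local Notation e := (@unit_itv R).

(* [1 + a cos t] and its normalized square [(1 + a cos t)^2 / (1 + a^2/2)]. *)
Definition cos_coef a : nat -> R := nth 0 [:: 0; a / 2; 1; a / 2; 0].

Definition cos_sqr_coef a : nat -> R :=
  let s := 1 + a ^+ 2 / 2 in
  nth 0 [:: a ^+ 2 / 4 / s; a / s; 1; a / s; a ^+ 2 / 4 / s].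

Lemma even_op_riesz_cos a m N : even_op (riesz (cos_coef a) m N).
Proof. exact: even_op_riesz. Qed.

Lemma even_op_riesz_cos_sqr a m N : even_op (riesz (cos_sqr_coef a) m N).
Proof. exact: even_op_riesz. Qed.

Lemma pentanomial_cosE a N f : pentanomial (cos_coef a) N f =
  f + (a / 2) *: (shift N%:R f + shift (- N%:R) f).
Proof. by rewrite pentanomialE//= scale0r addr0 scale1r. Qed.

(** For [A >= 0] commuting with shifts, positivity at the sum of [f] and its shift [T] bounds
    [ip (A T) f] below by [- ip (A f) f]; hence multiplying [A] by [1 + a cos] leaves at least
    [(1 - a) A]. *)
Lemma riesz_cos_nonneg a m N : 0 <= a <= 1 -> nonneg_op (riesz (cos_coef a) m N).
Proof.
move=> /andP[a0 a1]; elim: m N => [|m IH] N f fL; first exact: ip_ge0.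
have opA := even_op_riesz_cos a m (5 * N); move: (IH (5 * N)%N) => /= A0.
set A := riesz _ _ _ in opA A0 *; have AL := even_op_square_integrable opA.
have AfL := AL _ fL.
have TL b : SI (shift b f) by exact: square_integrable_shift.
have ATL b : SI (A (shift b f)) by exact: AL.
set T := shift N%:R f; have sym : ip (A (shift (- N%:R) f)) f = ip (A T) f.
  rewrite (even_op_shift opA) ip_shift_adj// opprK (even_op_selfadjoint opA)//.
  by rewrite ipC.
have qT : ip (A T) T = ip (A f) f by rewrite (even_op_shift opA) ip_shift.
have sym' : ip (A f) T = ip (A T) f by rewrite (even_op_selfadjoint opA fL (TL _)) ipC.
have := A0 _ (square_integrableD fL (TL N%:R)).
rewrite (even_opD opA) ipDl//; last exact: square_integrableD.
rewrite !ipDr// -/T qT sym' => pos.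
rewrite pentanomial_cosE (even_opD opA) (even_opZ opA) (even_opD opA).
have sumL := square_integrableD (ATL N%:R) (ATL (- N%:R)).
rewrite ipDl//; last exact: square_integrableZ.
rewrite ipZl// ipDl// -/T sym.
have q0 := A0 _ fL.
have -> : a / 2 * (ip (A T) f + ip (A T) f) = a * ip (A T) f by field.
have : 0 <= a * (ip (A f) f + ip (A T) f) by apply: mulr_ge0 => //; move: pos; lra.
have : 0 <= (1 - a) * ip (A f) f by rewrite mulr_ge0// subr_ge0.
lra.
Qed.

Lemma pentanomial_cos_sqr a N f :
  pentanomial (cos_coef a) N (pentanomial (cos_coef a) N f) =
  (1 + a ^+ 2 / 2) *: pentanomial (cos_sqr_coef a) N f.
Proof.
have s0 : 2 + a ^+ 2 != 0 by rewrite gt_eqF// ltr_pwDl// sqr_ge0.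
rewrite !pentanomial_cosE pentanomialE//= !(shiftD, shiftZ, shift_shift).
rewrite subrr addNr shift0 natrM.
have -> : N%:R + N%:R = 2 * N%:R :> R by rewrite mulrDl mul1r.
have -> : - N%:R - N%:R = - (2 * N%:R) :> R by rewrite mulrDl mul1r opprD.
by apply/funext => x; rewrite /cos_sqr_coef !fctE /GRing.scale/=; field.
Qed.

(** The factors commute, so the square of the product is the product of the squares, each
    contributing its normalization [1 + a ^+ 2 / 2]. *)
Lemma riesz_cos_sqrE a m N f :
  riesz (cos_coef a) m N (riesz (cos_coef a) m N f) =
  (1 + a ^+ 2 / 2) ^+ m *: riesz (cos_sqr_coef a) m N f.
Proof.
elim: m N f => [|m IH] N f /=; first by rewrite scale1r.
have opP : even_op (pentanomial (cos_coef a) N) by exact: even_op_pentanomial.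
have opA := even_op_riesz_cos a m (5 * N).
rewrite (even_op_commute opP opA) IH pentanomial_cos_sqr.
by rewrite (even_opZ (even_op_riesz_cos_sqr _ _ _)) scalerA [in RHS]exprSr.
Qed.

Lemma bernoulli_le (x : R) n : 0 <= x -> 1 + n%:R * x <= (1 + x) ^+ n.
Proof.
move=> x0; elim: n => [|n IH]; first by rewrite mul0r addr0.
rewrite exprS; apply: (@le_trans _ _ ((1 + x) * (1 + n%:R * x))).
  by rewrite -natr1; have := mulr_ge0 (mulr_ge0 (ler0n R n) x0) x0; lra.
by rewrite ler_wpM2l// addr_ge0.
Qed.

(** The exponent may be lowered to [2 + del] because [x <= 1]. This is how coefficients bounded by a
    small [a] become small in l_q while their l_2 norm is only bounded. *)
Lemma powR_le_sqr (a x q del : R) : 0 < a -> 0 < del -> 0 <= x <= 1 -> x <= a ->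
  2 + del <= q -> x `^ q <= a `^ del * x ^+ 2.
Proof.
move=> a0 del0 /andP[x0 x1] xa q2.
have [->|xn0] := eqVneq x 0.
  by rewrite powR0 ?expr0n ?mulr0// gt_eqF//; lra.
have xp : 0 < x by rewrite lt_neqAle eq_sym xn0.
apply: (@le_trans _ _ (x `^ (2 + del))).
  by rewrite ger_powR// xp x1.
rewrite powRD ?xn0 ?implybT// powR_mulrn// mulrC ler_wpM2r ?sqr_ge0//.
by rewrite ge0_ler_powR ?nnegrE// ltW.
Qed.

(* Since [C d = 1], a small [A g] says that [g] is close to a combination of its
   translates with the small coefficients [- C n], [n != d]. *)
Lemma approximation_step del : 0 < del -> exists d (C : nat -> R),
  [/\ (0 < d)%N, C d = 1,
    forall q, 2 + del <= q ->
      \sum_(n < (2 * d).+1 | n != d :> nat) `|C n| `^ q <= del &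
    forall N, (0 < N)%N -> exists A B, [/\ even_op A /\ even_op B,
      (forall f, SI f -> nrm (B f) <= nrm f), nrm (B e - e) <= del /\
      nrm (A (B e)) <= del,
      (forall f, A f = \sum_(n < (2 * d).+1) C n *: shift ((n%:R - d%:R) * N%:R) f) &
      forall Y, closed_invariant Y -> forall y, SI y -> Y (B y) -> Y y]].
Proof.
move=> del0.
pose rho0 := (del ^+ 2 / 8) ^+ 2.
have rho00 : 0 < rho0 by rewrite exprn_gt0// divr_gt0// exprn_gt0.
(* [K] will be [m * a ^+ 2]. By Bernoulli's inequality (1 + a^2/2)^m >= 1 + K/2, which exceeds
   [1 / rho0]. *)
have [K K0 KP] : exists2 K, (0 < K)%N & 2 / rho0 < K%:R.
  by exists (Num.truncn (2 / rho0)).+1 => //; exact: truncnS_gt.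
(* [L] will bound the sum of the squared coefficients, which is at most (1 + 3 a^2)^m. The condition
   [a <= th] then makes the l_q sum at most a^del L <= del. *)
pose L := expR (3 * K%:R) : R.
have L0 : 0 < L by exact: expR_gt0.
pose th := (del / L) `^ del^-1.
have th0 : 0 < th by rewrite powR_gt0// divr_gt0.
have [p p0 pP] : exists2 p, (0 < p)%N & th^-1 < p%:R.
  by exists (Num.truncn (th^-1)).+1 => //; exact: truncnS_gt.
(* Taking [a] as the inverse of the integer [p] allows [m = K * p ^ 2], so that [m * a ^+ 2] is
   exactly [K]. *)
have [a [a0 a1 ath1 [m m0 am]]] : exists a, [/\ 0 < a, a <= 1, a <= th &
    exists2 m, (0 < m)%N & m%:R * a ^+ 2 = K%:R].
  have p0' : 0 < p%:R :> R by rewrite ltr0n.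
  exists p%:R^-1; split.
  - by rewrite invr_gt0.
  - by rewrite invf_le1// ler1n.
  - by rewrite invf_ple ?posrE// ltW.
  exists (K * p ^ 2)%N; first by rewrite muln_gt0 K0 expn_gt0 p0.
  by rewrite natrM natrX exprVn mulfK// expf_neq0// gt_eqF.
have ath : a `^ del <= del / L.
  apply: (@le_trans _ _ (th `^ del)).
    by rewrite ge0_ler_powR ?nnegrE ?(ltW a0) ?(ltW th0) ?(ltW del0).
  by rewrite /th -powRrM mulVf ?gt_eqF// powRr1// divr_ge0 ?ltW.
pose s := 1 + a ^+ 2 / 2.
have s1 : 1 < s by rewrite ltrDl divr_gt0// exprn_gt0.
have s0 : 0 < s by apply: lt_trans s1.
pose d := center m; pose C := riesz_coef (cos_sqr_coef a) m.
have dm : (5 ^ m = (2 * d).+1)%N by rewrite -centerE addn1.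
have coef_ge0 i : (i < 5)%N -> 0 <= cos_sqr_coef a i.
  by move: i => [|[|[|[|[|]]]]]//= _; rewrite ?divr_ge0 ?sqr_ge0 ?ltW.
have coef_le i : (i < 5)%N -> i != 2%N -> cos_sqr_coef a i <= a.
  have h1 : a / s <= a by rewrite ler_pdivrMr// ler_peMr// ltW.
  have h2 : a ^+ 2 / 4 / s <= a.
    rewrite ler_pdivrMr//; apply: (@le_trans _ _ a); last by rewrite ler_peMr// ltW.
    have : a * a <= a * 1 by rewrite ler_pM2l.
    by rewrite expr2; lra.
  by move: i => [|[|[|[|[|]]]]].
have CP n : (0 <= C n <= 1) /\ (n != d -> C n <= a).
  by apply: riesz_coef_bound => //; rewrite (ltW a0).
exists d, C; split.
- by rewrite -(ltn_pmul2l (isT : 0 < 2)%N) -ltnS -dm muln0 -(expn0 5) ltn_exp2l.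
- exact: riesz_coef_center.
- move=> q q2; apply: (@le_trans _ _ (a `^ del * \sum_(n < (2 * d).+1) C n ^+ 2)).
    rewrite big_mkcond/= mulr_sumr; apply: ler_sum => n _.
    have [Cn Cna] := CP n; have /andP[Cn0 _] := Cn.
    case: ifPn => [nd|_]; last by rewrite mulr_ge0 ?powR_ge0 ?sqr_ge0.
    by rewrite ger0_norm//; apply: powR_le_sqr => //; exact: Cna.
  rewrite -dm sum_sqr_riesz_coef.
  apply: (@le_trans _ _ (del / L * L)); last by rewrite divfK// gt_eqF.
  apply: ler_pM => //; first exact: powR_ge0.
    by rewrite exprn_ge0// sumr_ge0// => i _; exact: sqr_ge0.
  have -> : L = expR (3 * a ^+ 2) ^+ m.
    by rewrite -expRM_natl mulrCA am.
  rewrite lerXn2r ?nnegrE ?expR_ge0//; first by rewrite sumr_ge0// => i _; exact: sqr_ge0.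
  apply: le_trans (expR_ge1Dx _).
  rewrite !big_ord_recl big_ord0 /cos_sqr_coef -/s /=.
  have h1 : (a / s) ^+ 2 <= a ^+ 2.
    rewrite lerXn2r ?nnegrE ?divr_ge0 ?(ltW a0) ?(ltW s0)//.
    by rewrite ler_pdivrMr// ler_peMr ?(ltW a0)// ltW.
  have h2 : (a ^+ 2 / 4 / s) ^+ 2 <= a ^+ 2 / 2.
    apply: (@le_trans _ _ ((a / 4) ^+ 2)); last by rewrite expr_div_n; have := sqr_ge0 a; lra.
    rewrite lerXn2r ?nnegrE ?divr_ge0 ?sqr_ge0 ?(ltW a0) ?(ltW s0)//.
    rewrite ltW// ltr_pdivrMr//.
    have : a * a <= a * 1 by rewrite ler_pM2l.
    have : a * 1 < a * s by rewrite ltr_pM2l.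
    by rewrite expr2; lra.
  rewrite expr1n; move: h1 h2 (sqr_ge0 a).
  by move: ((a ^+ 2 / 4 / s) ^+ 2) ((a / s) ^+ 2) => u v; lra.
move=> N N0.
(* This factor, s^(-m/2), makes [W^2] the normalized Riesz product. It is also the value of
   [ip (W e) e], as [riesz (cos_coef a) m N] has mean 1. *)
pose rho := Num.sqrt s^-1 ^+ m.
have rho_ge0 : 0 <= rho by rewrite exprn_ge0// sqrtr_ge0.
have rho2 : rho ^+ 2 = s ^- m.
  by rewrite /rho -exprM mulnC exprM sqr_sqrtr ?exprVn// invr_ge0 ltW.
have rho_le : rho <= del ^+ 2 / 8.
  rewrite -(@ler_pXn2r _ 2)// ?nnegrE ?divr_ge0 ?sqr_ge0// -/rho0 rho2.
  rewrite invf_ple ?posrE//; last by rewrite exprn_gt0.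
  apply: le_trans (bernoulli_le m (_ : 0 <= a ^+ 2 / 2)); last by rewrite divr_ge0 ?sqr_ge0.
  rewrite mulrA am; move: KP; lra.
pose W f := rho *: riesz (cos_coef a) m N f.
have opW : even_op W by exact: (even_op_comp (even_op_scale _) (even_op_riesz_cos _ _ _)).
have WWE f : W (W f) = riesz (cos_sqr_coef a) m N f.
  rewrite /W (even_opZ (even_op_riesz_cos _ _ _)) riesz_cos_sqrE !scalerA.
  by rewrite mulrA -expr2 rho2 mulVf ?scale1r// expf_neq0// gt_eqF.
have W0 : nonneg_op W.
  move=> f fL; rewrite ipZl//; last exact: (even_op_square_integrable (even_op_riesz_cos _ _ _)).
  by rewrite mulr_ge0// riesz_cos_nonneg// (ltW a0).
have We : ip (W e) e <= del ^+ 2 / 8.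
  have eL := @square_integrable_unit_itv R.
  have ReL := even_op_square_integrable (even_op_riesz_cos a m N) eL.
  by rewrite ipZl// ip_riesz_unit_itv// mulr1.
have [B [opB Bc Be WBe BY]] := regularization opW W0 del0 We.
exists (fun f => W (W f)), B; split => //; first by split => //; exact: even_op_comp.
by move=> f; rewrite WWE rieszE dm.
Qed.

End ApproximationStep.

(** * Density of the span of the rational translates *)

Section Density.
Context {R : realType}.
Implicit Types (f g h : R -> R) (a b c s : R) (A : set R).

Local Notation SI := square_integrable.
Local Notation e := (@unit_itv R).
Notation mu := (@lebesgue_measure R).

Definition rat_closed_invariant (Y : set (R -> R)) : Prop :=
  [/\ forall f, Y f -> SI f,
      forall f g, Y f -> Y g -> Y (f + g),
      forall c f, Y f -> Y (c *: f),
      forall (q : rat) f, Y f -> Y (shift (ratr q) f) &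
      forall f, SI f ->
        (forall eps, 0 < eps -> exists2 g, Y g & nrm (f - g) <= eps) -> Y f].

Lemma rat_closed_invariantW Y : rat_closed_invariant Y -> closed_invariant Y.
Proof.
move=> [YL YD YZ Ys Yc]; split => // n f Yf.
by have := Ys n%:~R f Yf; rewrite ratr_int.
Qed.

(** Dominated convergence, from (f - f_n)^2 <= 4 f^2. *)
Lemma square_integrable_dominated f (f_ : nat -> R -> R) : SI f ->
  (forall n, measurable_fun [set: R] (f_ n)) ->
  (forall n x, `|f_ n x| <= `|f x|) -> (forall x, f_ n x @[n --> \oo] --> f x) ->
  (forall n, SI (f_ n)) /\
  (forall eps, 0 < eps -> exists n, nrm (f - f_ n) <= eps).
Proof.
move=> fL mf fle cf; have /square_integrableP[mf0 fi] := fL.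
have f_L n : SI (f_ n).
  apply/square_integrableP; split => //.
  apply: (le_integrable measurableT _ _ fi).
    by apply/measurable_EFinP; apply: measurable_funX; exact: mf.
  move=> x _ /=; rewrite lee_fin !ger0_norm ?sqr_ge0//.
  by rewrite -(real_normK (num_real (f_ n x))) -(real_normK (num_real (f x)))
    lerXn2r ?nnegrE.
split=> // eps eps0.
have dL n := square_integrableB fL (f_L n).
have [|||||_ _] := @dominated_convergence _ _ _ mu setT measurableT
    (fun n => EFin \o (fun x => (f x - f_ n x) ^+ 2)) (cst 0%E)
    (EFin \o (fun x => 4 * f x ^+ 2)).
- move=> n; apply/measurable_EFinP; apply: measurable_funX.
  by apply: measurable_funB => //; exact: mf.
- exact: measurable_cst.
- apply/nearW => x _ /=; apply: cvg_EFin; first exact: nearW.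
  have -> : 0 = (f x - f x) ^+ 2 :> R by rewrite subrr expr0n.
  apply: (@cvg_comp _ _ _ (fun n => f x - f_ n x) (fun y : R => y ^+ 2));
    last exact: exprn_continuous.
  by apply: cvgB => //; exact: cvg_cst.
- have := integrableZl measurableT 4 fi.
  by apply: eq_integrable.
- apply/nearW => x n _ /=; rewrite lee_fin ger0_norm ?sqr_ge0//.
  have := fle n x; rewrite !ler_norml.
  have -> : 4 * f x ^+ 2 = (2 * `|f x|) ^+ 2.
    by rewrite exprMn real_normK ?num_real//; ring.
  move=> /andP[h1 h2]; rewrite -(real_normK (num_real (_ - _))).
  rewrite lerXn2r ?nnegrE ?mulr_ge0// ler_norml.
  have := ler_norm (f x); have := ler_norm (- f x); rewrite normrN.
  by move=> *; apply/andP; split; lra.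
rewrite integral_cst// mul0e => /fine_cvgP[_].
move/cvgr_le => /(_ (eps ^+ 2) (exprn_gt0 _ eps0))[n _ /(_ n (leqnn n))/= nP].
by exists n; rewrite nrm_le; [exact: nP|exact: ltW].
Qed.

Lemma itvoc_cat a b c : a <= b -> b <= c -> itvoc a c = itvoc a b + itvoc b c.
Proof.
move=> ab bc; apply/funext => x; rewrite fctE !itvocE.
have [ax|xa] := ltP a x; have [xb|bx] := leP x b; have [xc|cx] := leP x c => //=;
  rewrite ?addr0 ?add0r//.
all: exfalso; lra.
Qed.

Lemma itvoc_nil a : itvoc a a = 0.
Proof.
by apply/funext => x; rewrite itvocE; case: ltP.
Qed.

(** * Closed subspaces invariant under rational shifts and containing [unit_itv] *)

Section Generated.
Variable Y : set (R -> R).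
Hypothesis Yinv : rat_closed_invariant Y.
Hypothesis Ye : Y e.

Let YL f : Y f -> SI f. Proof. by case: Yinv => H _ _ _ _; exact: H. Qed.
Let YD f g : Y f -> Y g -> Y (f + g). Proof. by case: Yinv => _ H _ _ _; exact: H. Qed.
Let YZ c f : Y f -> Y (c *: f). Proof. by case: Yinv => _ _ H _ _; exact: H. Qed.
Let Ys (q : rat) f : Y f -> Y (shift (ratr q) f).
Proof. by case: Yinv => _ _ _ H _; exact: H. Qed.
Let Yc f : SI f ->
  (forall eps, 0 < eps -> exists2 g, Y g & nrm (f - g) <= eps) -> Y f.
Proof. by case: Yinv => _ _ _ _ H; exact: H. Qed.
Let YB f g : Y f -> Y g -> Y (f - g).
Proof. by move=> Yf Yg; apply: YD => //; rewrite -scaleN1r; exact: YZ. Qed.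
Let Y0 : Y 0. Proof. by rewrite -(scale0r e); exact: YZ. Qed.
Let Ysum (I : Type) (r : seq I) (F : I -> R -> R) :
  (forall i, Y (F i)) -> Y (\sum_(i <- r) F i).
Proof. by move=> YF; apply: big_ind => // [f g]; exact: YD. Qed.

(** With [v n] the indicator of []n, n + s]], the difference of [e] and its shift by [s] is
    [v 0 - v 1], and telescoping gives [v 0 - v n]. The mean of [n] such differences misses [v 0] by
    a mean of [n] orthogonal functions of norm sqrt(s), which has norm sqrt(s/n). *)
Lemma generated_short_itv (q : rat) : 0 <= (ratr q : R) <= 1 -> Y (itvoc 0 (ratr q)).
Proof.
set s : R := ratr q => /andP[s0 s1].
pose v n := itvoc n%:R (n%:R + s).
have vL n : SI (v n) by exact: square_integrable_itvoc.
have v01 : Y (v 0%N - v 1%N).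
  have -> : v 0%N - v 1%N = e - shift s e.
    have e1 : e = itvoc 0 s + itvoc s 1 by exact: itvoc_cat.
    have e2 : shift s e = itvoc s 1 + itvoc 1 (1 + s).
      by rewrite shift_itvoc add0r; apply: itvoc_cat; lra.
    by rewrite e2 {1}e1 opprD addrA addrK /v add0r.
  by apply: YB => //; exact: Ys.
have vn n : Y (v 0%N - v n).
  elim: n => [|n IH]; first by rewrite subrr.
  have -> : v 0%N - v n.+1 = (v 0%N - v n) + shift n%:R (v 0%N - v 1%N).
    have -> : shift n%:R (v 0%N - v 1%N) = v n - v n.+1.
      rewrite -[shift _ _]/(shift n%:R (v 0%N) - shift n%:R (v 1%N)).
      rewrite !shift_itvoc /v !add0r -!natr1.
      by congr (itvoc _ _ - itvoc _ _); ring.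
    by rewrite subrKA.
  by apply: YD => //; have := Ys n%:R v01; rewrite ratr_nat.
have sumv n : ip (\sum_(i < n) v i.+1) (\sum_(i < n) v i.+1) = n%:R * s.
  elim: n => [|n IH]; first by rewrite big_ord0 ip0l mul0r.
  have SL : SI (\sum_(i < n) v i.+1) by exact: square_integrable_sum.
  rewrite big_ord_recr/= ipDD// IH ip_suml// big1 ?mulr0 ?addr0 => [|i _].
    rewrite ip_itvoc_diag ?lerDl// -[in RHS]natr1; ring.
  apply: ip_itvoc_disjoint.
  have : (i.+1 < n.+1)%N by rewrite ltnS.
  by rewrite -(ler_nat R) -natr1 => h; apply: le_trans h; rewrite lerD2l.
have -> : itvoc 0 s = v 0%N by rewrite /v add0r.
apply: Yc => // eps eps0.
pose n := (Num.truncn (eps ^- 2)).+1.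
have n0 : 0 < n%:R :> R by rewrite ltr0n.
exists (n%:R^-1 *: \sum_(i < n) (v 0%N - v i.+1)); first by apply: YZ; exact: Ysum.
have -> : v 0%N - n%:R^-1 *: (\sum_(i < n) (v 0%N - v i.+1)) =
    n%:R^-1 *: \sum_(i < n) v i.+1.
  rewrite sumrB scalerBr sumr_const card_ord -(scaler_nat n (v 0%N)) scalerA mulVf ?gt_eqF//.
  by rewrite scale1r subKr.
have SL : SI (\sum_(i < n) v i.+1) by exact: square_integrable_sum.
rewrite nrm_le; last exact: ltW.
rewrite ipZl ?ipZr ?sumv//; last exact: square_integrableZ.
rewrite mulKf ?gt_eqF// mulrC ler_pdivrMr//.
apply: le_trans s1 _; rewrite mulrC -ler_pdivrMr ?exprn_gt0// mul1r ltW//.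
exact: truncnS_gt.
Qed.

(** The interval is cut into [n] rational translates of []0, s]] with [s <= 1]. *)
Lemma generated_rat_itv (p q : rat) : (ratr p : R) <= ratr q ->
  Y (itvoc (ratr p) (ratr q)).
Proof.
rewrite ler_rat => pq.
have [n n0 qpn] : exists2 n, (0 < n)%N & q - p <= n%:R.
  by exists (Num.truncn (q - p)).+1 => //; rewrite ltW// truncnS_gt.
have n0' : 0 < n%:R :> rat by rewrite ltr0n.
pose s : rat := (q - p) / n%:R.
have s0 : 0 <= s by rewrite divr_ge0 ?subr_ge0// ltW.
have s1 : s <= 1 by rewrite ler_pdivrMr// mul1r.
have sR : 0 <= (ratr s : R) <= 1 by rewrite ler0q s0/= -(rmorph1 ratr) ler_rat.
have -> : q = p + n%:R * s by rewrite mulrC divfK ?gt_eqF// subrKC.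
move: s s0 sR {s1} => s; elim: n {n0 qpn n0'} => [|n IH] s0 sR.
  by rewrite mul0r addr0 itvoc_nil.
have s0R : 0 <= (ratr s : R) by rewrite ler0q.
have le1 : (ratr p : R) <= ratr (p + n%:R * s) by rewrite ler_rat lerDl mulr_ge0.
have le2 : (ratr (p + n%:R * s) : R) <= ratr (p + n.+1%:R * s).
  by rewrite ler_rat lerD2l ler_wpM2r// ler_nat.
rewrite (itvoc_cat le1 le2).
apply: YD; first exact: IH.
have := Ys (p + n%:R * s) (generated_short_itv sR).
rewrite shift_itvoc add0r -raddfD/=.
by have -> : s + (p + n%:R * s) = p + n.+1%:R * s by rewrite -natr1; ring.
Qed.

Lemma generated_itv a b : a <= b -> Y (itvoc a b).
Proof.
rewrite le_eqVlt => /predU1P[->|ab]; first by rewrite itvoc_nil.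
apply: Yc; first exact: square_integrable_itvoc.
move=> eps eps0.
(* The first bound keeps [a' < b], so that the rational interval is not empty; the second gives each
   of the two end pieces norm at most [eps / 2]. *)
pose eta := Num.min (b - a) ((eps / 2) ^+ 2).
have eta0 : 0 < eta by rewrite lt_min subr_gt0 ab exprn_gt0// divr_gt0.
have eta1 : eta <= b - a by rewrite ge_min lexx.
have eta2 : Num.sqrt eta <= eps / 2.
  have -> : eps / 2 = Num.sqrt ((eps / 2) ^+ 2) by rewrite sqrtr_sqr ger0_norm// divr_ge0 ?ltW.
  by rewrite ler_wsqrtr// ge_min lexx orbT.
have /rat_in_itvoo[p] : a < a + eta by rewrite ltrDl.
rewrite in_itv/= => /andP[ap pa].
have /rat_in_itvoo[q] : b < b + eta by rewrite ltrDl.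
rewrite in_itv/= => /andP[bq qb].
set a' : R := ratr p in ap pa *; set b' : R := ratr q in bq qb *.
exists (itvoc a' b'); first by apply: generated_rat_itv; rewrite -/a' -/b'; lra.
have -> : itvoc a b - itvoc a' b' = itvoc a a' - itvoc b b'.
  have e1 : itvoc a b' = itvoc a b + itvoc b b' by apply: itvoc_cat; lra.
  have e2 : itvoc a b' = itvoc a a' + itvoc a' b' by apply: itvoc_cat; lra.
  have e3 : itvoc a b + itvoc b b' = itvoc a a' + itvoc a' b' by rewrite -e1.
  by apply/eqP; rewrite subr_eq addrAC eq_sym subr_eq -e3.
apply: le_trans (nrmB _ _) _; try exact: square_integrable_itvoc.
rewrite !nrm_itvoc ?(ltW ap) ?(ltW bq)//.
have h1 : Num.sqrt (a' - a) <= Num.sqrt eta by rewrite ler_wsqrtr//; lra.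
have h2 : Num.sqrt (b' - b) <= Num.sqrt eta by rewrite ler_wsqrtr//; lra.
move: h1 h2 eta2; lra.
Qed.

Let I (M : nat) : set R := `]- M%:R, M%:R]%classic.

Let mI M : measurable (I M). Proof. exact: measurable_itv. Qed.

Let muI M A : measurable A -> (mu (A `&` I M) < +oo)%E.
Proof.
move=> mA; apply: (@le_lt_trans _ _ (mu (I M))).
  apply: le_measure; rewrite ?inE; [exact: (measurableI _ _ mA (mI M))|exact: mI|].
  exact: subIsetr.
by rewrite lebesgue_measure_itv /=; case: ifPn => // _; rewrite -EFinB ltry.
Qed.

(** The pi-lambda theorem for half-open intervals; cutting with the bounded [I M] keeps every
    indicator square integrable. *)
Lemma generated_bounded_set M A : measurable A -> Y (\1_(A `&` I M) : R -> R).
Proof.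
apply: (@dynkin_induction _ (measurableTypeR R) (@ocitv R)
  (fun A => Y (\1_(A `&` I M) : R -> R))) => //.
- exact: ocitvI.
- by rewrite setTI; apply: generated_itv; have := ler0n R M; lra.
- move=> _ /= [[a b]] _ <-.
  pose c := Num.max a (- M%:R); pose d := Num.min b M%:R.
  have -> : \1_(`]a, b] `&` I M) = (itvoc c d : R -> R).
    rewrite /itvoc; congr (\1_ _); apply/seteqP; split => x; rewrite /I /= !in_itv/=.
      by move=> [/andP[h1 h2] /andP[h3 h4]]; rewrite gt_max h1 h3 le_min h2 h4.
    by rewrite gt_max le_min => /andP[/andP[-> ->] /andP[-> ->]].
  have [cd|dc] := leP c d; first exact: generated_itv.
  have -> : itvoc c d = 0; last exact: Y0.
  apply/funext => x; rewrite itvocE.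
  by case: ltP => //= cx; rewrite leNgt (lt_trans dc cx).
- move=> B mB YB'.
  have -> : \1_(~` B `&` I M) = \1_(setT `&` I M) - \1_(B `&` I M) :> (R -> R).
    apply/funext => x; rewrite !fctE !indicE !in_setI in_setC in_setT/=.
    by case: (x \in B); case: (x \in I M); rewrite /= ?subrr ?subr0.
  by apply: YB => //; rewrite setTI; apply: generated_itv; have := ler0n R M; lra.
move=> F mF tF YF.
(* Disjointness makes the indicator of a finite union a sum; the countable union follows by
   dominated convergence. *)
pose U n := \big[setU/set0]_(k < n) F k.
have mU n : measurable (U n) by exact: bigsetU_measurable.
have YU n : Y (\1_(U n `&` I M) : R -> R).
  elim: n => [|n IH]; first by rewrite /U big_ord0 set0I indic0.
  have -> : \1_(U n.+1 `&` I M) = \1_(U n `&` I M) + \1_(F n `&` I M) :> (R -> R).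
    apply/funext => x; rewrite fctE !indicE !in_setI /U big_ord_recr/= in_setU.
    have [xF|] := boolP (x \in F n); rewrite ?orbF ?orbT/= ?addr0//.
    have -> : (x \in \big[setU/set0]_(i < n) F i) = false; last by rewrite add0r.
    apply/negbTE; rewrite notin_setE -bigcup_mkord => -[k /= kn Fkx].
    have := tF k n Logic.I Logic.I; rewrite inE in xF => /(_ (ex_intro _ x (conj Fkx xF))).
    by move=> kn'; rewrite kn' ltnn in kn.
  exact: YD.
have mUF : measurable (\bigcup_k F k) by exact: bigcup_measurable.
have fL : SI (\1_((\bigcup_k F k) `&` I M) : R -> R).
  by apply: square_integrable_indic; [exact: measurableI|exact: muI].
apply: Yc => // eps eps0.
have [|||_ H] := @square_integrable_dominated _ (fun n => \1_(U n `&` I M)) fL.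
- by move=> n; apply: measurable_indic; exact: (measurableI _ _ (mU n) (mI M)).
- move=> n x; rewrite !indicE !in_setI !ger0_norm// ler_nat.
  have [|//] := boolP (x \in U n); have [//|/=] := boolP (x \in \bigcup_k F k).
  rewrite notin_setE inE /U -bigcup_mkord => nU [k _ Fkx].
  by exfalso; apply: nU; exists k.
- move=> x; apply: cvg_near_cst.
  have [[k _ Fkx]|nU] := pselect ((\bigcup_k F k) x); last first.
    apply: nearW => n; rewrite !indicE !in_setI.
    have -> : (x \in \bigcup_k F k) = false by apply/negbTE; rewrite notin_setE.
    have -> // : (x \in U n) = false.
    apply/negbTE; rewrite notin_setE /U -bigcup_mkord => -[k _ Fkx].
    by apply: nU; exists k.
  exists k.+1 => // n /= kn; rewrite !indicE !in_setI.
  have -> : x \in \bigcup_k F k by rewrite inE; exists k.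
  by have -> : x \in U n by rewrite inE /U -bigcup_mkord; exists k.
by have [n Hn] := H _ eps0; exists (\1_(U n `&` I M)).
Qed.

Import HBNNSimple.

Lemma generated_nneg f : SI f -> (forall x, 0 <= f x) -> Y f.
Proof.
move=> fL f0; have mf := square_integrable_measurable fL.
have [g [gnd gf]] : exists g : {nnsfun (R : measurableType _) >-> R}^nat,
    nondecreasing_seq (g : (R -> R)^nat) /\
    (forall x, [set: R] x -> EFin \o g^~ x @ \oo --> (EFin \o f) x).
  apply: approximation => //; first exact/measurable_EFinP.
  by move=> x _; rewrite lee_fin.
have gf' x : g n x @[n --> \oo] --> f x.
  by have := gf x Logic.I; move/fine_cvgP => [_].
have gle n x : g n x <= f x.
  have -> : f x = lim (g n x @[n --> \oo]) by apply/esym/cvg_lim.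
  apply: limr_ge; first by apply/cvg_ex; exists (f x).
  by exists n => // m /= nm; have /lefP := gnd n m nm.
(* The cut-off brings the level sets under [generated_bounded_set] and leaves the pointwise limit
   unchanged. *)
pose f_ n : R -> R := fun x => g n x * \1_(I n) x.
have Yf_ n : Y (f_ n).
  have -> : f_ n = \sum_(y <- finmap.enum_fset (fset_set (range (g n))))
      y *: (\1_((g n @^-1` [set y]) `&` I n) : R -> R).
    apply/funext => x; rewrite /f_ fimfunE fsbig_finite//= fct_sumE.
    rewrite big_distrl/=; apply: eq_bigr => y _.
    by rewrite indicI !fctE /GRing.scale/= mulrA.
  by apply: Ysum => y; apply: YZ; exact: generated_bounded_set.
apply: Yc => // eps eps0.
have [|||_ H] := @square_integrable_dominated _ f_ fL.
- by move=> n; apply: square_integrable_measurable; apply: YL; exact: Yf_.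
- move=> n x; rewrite /f_ normrM !ger0_norm//.
  by apply: le_trans (gle n x); rewrite ler_piMr// indicE lern1 leq_b1.
- move=> x; rewrite -[f x]mulr1; apply: cvgM => //; apply: cvg_near_cst.
  exists (Num.truncn `|x|).+1 => // n /= xn; rewrite indicE mem_set//=.
  have : `|x| < n%:R by apply: (lt_le_trans (truncnS_gt _)); rewrite ler_nat.
  by rewrite /I /= in_itv/= ltr_norml => /andP[-> /ltW].
by have [n Hn] := H _ eps0; exists (f_ n).
Qed.

Theorem generated_all f : SI f -> Y f.
Proof.
move=> fL; pose g : R -> R := fun x => `|f x|.
have gL : SI g.
  have /square_integrableP[mf fi] := fL.
  apply/square_integrableP; split; first exact: measurableT_comp.
  by apply: eq_integrable fi => // x _ /=; rewrite real_normK ?num_real.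
have -> : f = 2^-1 *: (g + f) - 2^-1 *: (g - f).
  by apply/funext => x; rewrite !fctE /GRing.scale/=; field.
apply: YB; apply: YZ; apply: generated_nneg.
- exact: square_integrableD.
- by move=> x; rewrite !fctE /g; have := ler_norm (- f x); rewrite normrN; lra.
- exact: square_integrableB.
- by move=> x; rewrite !fctE /g; have := ler_norm (f x); lra.
Qed.

End Generated.
End Density.

(** * Infinite products of contractions *)

Section InfiniteProduct.
Context {R : realType}.
Implicit Types (f g h : R -> R) (k j n : nat).

Local Notation SI := square_integrable.
Local Notation e := (@unit_itv R).

Variable B : nat -> (R -> R) -> R -> R.
Hypothesis opB : forall k, even_op (B k).
Hypothesis Bc : forall k f, SI f -> nrm (B k f) <= nrm f.
Hypothesis Be : forall k, nrm (B k e - e) <= 2 ^- k.+1.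

Let BL k f : SI f -> SI (B k f).
Proof. exact: even_op_square_integrable. Qed.

(** The factors are [B k], ..., [B (k + j - 1)]. The starting index serves the tails [g k] of the
    infinite product, which satisfy [g k = B k (g k.+1)]. *)
Fixpoint partial_product k j : R -> R :=
  if j is j'.+1 then B k (partial_product k.+1 j') else e.

Local Notation G := partial_product.

Lemma partial_product_SI k j : SI (G k j).
Proof. by elim: j k => [|j IH] k /=; [exact: square_integrable_unit_itv|exact: BL]. Qed.
Local Hint Resolve partial_product_SI : core.

Lemma step_fun_unit_itv : step_fun e.
Proof.
move=> t; rewrite /unit_itv !itvocE; congr (_%:R).
by rewrite ltr0z ceil_gt0 -[1 in RHS]/(1%:~R) ler_int ceil_le_int.
Qed.

Lemma partial_product_step k j : step_fun (G k j).
Proof.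
by elim: j k => [|j IH] k /=; [exact: step_fun_unit_itv|exact: even_op_step_fun].
Qed.

(** The two products differ in the innermost place only, by [B (k + j) e - e]; the outer factors are
    contractions. *)
Lemma partial_product_succ k j : nrm (G k j.+1 - G k j) <= 2 ^- (k + j).+1.
Proof.
elim: j k => [|j IH] k; first by rewrite addn0; exact: Be.
rewrite -[X in nrm X]/(B k (G k.+1 j.+1) - B k (G k.+1 j)) -(even_opB (opB k)).
apply: le_trans (Bc _ _) _; first exact: square_integrableB.
by rewrite -addSnnS; exact: IH.
Qed.

Lemma partial_product_cauchy k i j : (i <= j)%N ->
  nrm (G k j - G k i) <= 2 ^- (k + i) :> R.
Proof.
move=> ij; suff : nrm (G k j - G k i) <= 2 ^- (k + i) - 2 ^- (k + j) :> R.
  by move=> h; apply: le_trans h _; rewrite gerBl invr_ge0 exprn_ge0.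
elim: j ij => [|j IH]; first by rewrite leqn0 => /eqP ->; rewrite !subrr nrm0.
rewrite leq_eqVlt ltnS => /predU1P[->|ij]; first by rewrite !subrr nrm0.
have := @nrm_dist_le _ (G k j.+1) (G k j) (G k i).
move=> /(_ (partial_product_SI _ _) (partial_product_SI _ _) (partial_product_SI _ _)).
move=> h; apply: le_trans h _; apply: le_trans (lerD (partial_product_succ k j) (IH ij)) _.
rewrite addnS exprS invfM; lra.
Qed.

(** The partial products are step functions, so they converge at every point and the recursion for
    [g] is an equality of functions. *)
Lemma infinite_product : exists g : nat -> R -> R,
  [/\ forall k, SI (g k),
      forall k n, nrm (g k - G k n) <= 2 ^- (k + n),
      forall k, g k = B k (g k.+1) &
      forall eps, 0 < eps -> forall k, exists n0, forall n, (n0 <= n)%N ->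
        nrm (g k - G k n) <= eps].
Proof.
have tau0 k : (fun n => 2 ^- (k + n)) @ \oo --> (0 : R).
  have -> : (fun n => 2 ^- (k + n)) = geometric (2 ^- k) 2^-1 :> (nat -> R).
    by apply/funext => n; rewrite /geometric/= exprD invfM exprVn.
  by apply: cvg_geometric; rewrite ger0_norm ?invr_ge0// invf_lt1// ltr1n.
have /choice[g gP] : forall k, exists f, [/\ SI f, step_fun f,
    forall t, G k n t @[n --> \oo] --> f t &
    forall n, nrm (f - G k n) <= 2 ^- (k + n)].
  move=> k; apply: step_fun_limit => //.
  - exact: partial_product_step.
  - by move=> i j; exact: partial_product_cauchy.
have gcv k t : G k n t @[n --> \oo] --> g k t by case: (gP k).
exists g; split.
- by move=> k; case: (gP k).
- by move=> k; case: (gP k).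
- move=> k; apply/funext => t.
  have h1 : G k n.+1 t @[n --> \oo] --> g k t.
    by have := gcv k t; rewrite -(cvg_shiftS (fun n => G k n t)).
  have h2 : G k n.+1 t @[n --> \oo] --> B k (g k.+1) t.
    by apply: (even_op_pointwise (opB k)) => s; exact: gcv.
  exact: (cvg_unique _ h1 h2).
- move=> eps eps0 k; have := tau0 k; move/cvgr_le => /(_ eps eps0)[n0 _ n0P].
  exists n0 => n n0n; case: (gP k) => _ _ _ /(_ n) h; apply: le_trans h _.
  exact: n0P.
Qed.

(** Each factor commutes with shifts and is self-adjoint, so it moves onto [f], whose norm it does
    not increase; what remains is Bessel's inequality for orthonormal translates of [e]. *)
Lemma partial_product_bessel (lam : nat -> R) k j N f :
  (forall m n, m != n -> 1 <= `|lam m - lam n|) -> SI f ->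
  \sum_(n < N) ip f (shift (lam n) (G k j)) ^+ 2 <= ip f f.
Proof.
move=> lam1; elim: j k f => [|j IH] k f fL /=.
  apply: (@bessel_orthonormal _ N (fun n => shift (lam n) e)) => //.
    by move=> n; apply: square_integrable_shift; exact: square_integrable_unit_itv.
  move=> m n; have [->|mn] := eqVneq m n; last exact/ip_shift_unit_itv/lam1.
  by rewrite ip_shift ?ip_unit_itv//; exact: square_integrable_unit_itv.
have -> : \sum_(n < N) ip f (shift (lam n) (B k (G k.+1 j))) ^+ 2 =
    \sum_(n < N) ip (B k f) (shift (lam n) (G k.+1 j)) ^+ 2.
  apply: eq_bigr => n _; rewrite -(even_op_shift (opB k)) (even_op_selfadjoint (opB k))//.
  exact: square_integrable_shift.
by apply: le_trans (IH _ _ (BL k fL)) _; rewrite -nrm_leq Bc.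
Qed.

(** The factor [B k] occurs in [G i j] because [i <= k < i + j]; the other factors are contractions
    commuting with [A] and [B k]. *)
Lemma partial_product_small (A : (R -> R) -> R -> R) c i k j : even_op A ->
  nrm (A (B k e)) <= c -> (i <= k)%N -> (k < i + j)%N -> nrm (A (G i j)) <= c.
Proof.
move=> opA Ac; have AL := even_op_square_integrable opA.
have small n l : nrm (A (B k (G n l))) <= c.
  elim: l n => [|l IH] n //=.
  rewrite (even_op_commute (opB k) (opB n)) (even_op_commute opA (opB n)).
  by apply: le_trans (Bc _ _) (IH _); exact/AL/BL.
elim: j i => [|j IH] i ik kij; first by rewrite addn0 ltnNge ik in kij.
have [->|ik'] := eqVneq i k; first exact: small.
rewrite /= (even_op_commute opA (opB i)); apply: le_trans (Bc _ _) _; first exact: AL.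
by apply: IH; [rewrite ltn_neqAle ik'|rewrite addSnnS].
Qed.

End InfiniteProduct.

(** * The schedule of translates *)

Section Schedule.
Context {R : realType}.
Implicit Types (k l n : nat).

(** The exponent of 2 in [k.+1] takes every value infinitely often; it is read as the code of a
    rational, with 0 where it is no code. *)
Definition rat_seq k : rat := odflt 0 (unpickle (logn 2 k.+1)).

Lemma rat_seq_cofinal (r : rat) k0 : exists2 k, (k0 <= k)%N & rat_seq k = r.
Proof.
(* The odd factor pushes the index beyond [k0] without changing the exponent of 2. *)
pose m := (2 ^ pickle r * (2 * k0).+1)%N.
have m0 : (0 < m)%N by rewrite muln_gt0 expn_gt0.
exists m.-1.
  rewrite -ltnS prednK//; apply: leq_trans (_ : (2 * k0).+1 <= _)%N; first by lia.
  by rewrite leq_pmull// expn_gt0.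
rewrite /rat_seq prednK// lognM ?expn_gt0// pfactorK// logn_coprime ?addn0 ?pickleK//.
by rewrite coprime2n /= oddM.
Qed.

Variable d : nat -> nat.
Hypothesis d0 : forall k, (0 < d k)%N.

Definition rat_bound k : nat := (Num.truncn `|ratr (rat_seq k) : R|).+1.

(* A bound for the nodes of all the stages before [k]. *)
Fixpoint radius k : nat :=
  if k is k'.+1
  then (radius k' + (radius k' + 2 * rat_bound k' + 1) * d k' + rat_bound k')%N
  else 0%N.

(** Large enough for every node of stage [k] to have absolute value at least [radius k + 1],
    although the centre may be as far as [rat_bound k] from 0. *)
Definition gap k : nat := (radius k + 2 * rat_bound k + 1)%N.

(* The nodes of stage [k] form an arithmetic progression centred at
   [rat_seq k], with its centre left out. *)
Definition node (kn : nat * nat) : R :=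
  ratr (rat_seq kn.1) + (kn.2%:R - (d kn.1)%:R) * (gap kn.1)%:R.

Definition node_index : set (nat * nat) :=
  [set kn | (kn.2 < (2 * d kn.1).+1)%N && (kn.2 != d kn.1)].

Lemma normr_rat_seq k : `|ratr (rat_seq k) : R| <= (rat_bound k)%:R.
Proof. by rewrite ltW// truncnS_gt. Qed.

Lemma leq_radius k l : (k <= l)%N -> (radius k <= radius l)%N.
Proof.
move/subnK <-; elim: (l - k)%N => //= n IH.
by apply: leq_trans IH _; rewrite -addnA leq_addr.
Qed.

(** Within a stage the spacing is a multiple of the gap. For different stages, the nodes of the
    later one, [l], are at least [radius l + 1] in absolute value, those of the earlier one at most
    [radius l]. *)
Lemma node_separated x y : node_index x -> node_index y -> x != y ->
  1 <= `|node x - node y|.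
Proof.
move: x y => [k m] [l n].
wlog kl : k m l n / (k <= l)%N.
  move=> H; have [kl|/ltnW lk] := leqP k l; first exact: H.
  by move=> Ix Iy xy; rewrite distrC; apply: H => //; rewrite eq_sym.
rewrite /node_index /node /= => /andP[m2 md] /andP[n2 nd] xy.
have [klE|nkl] := eqVneq k l.
  move: xy; rewrite klE xpair_eqE eqxx/= => mn.
  rewrite (_ : _ - _ = (m%:R - n%:R) * (gap l)%:R); last by ring.
  rewrite normrM normr_nat; apply: le_trans (normr_natB_ge1 mn) _.
  by rewrite ler_peMr// ler1n /gap addn1.
have k_lt_l : (k < l)%N by rewrite ltn_neqAle nkl.
have small : `|ratr (rat_seq k) + (m%:R - (d k)%:R) * (gap k)%:R : R| <= (radius l)%:R.
  apply: (@le_trans _ _ (radius k.+1)%:R); last by rewrite ler_nat leq_radius.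
  rewrite [radius _]/= -/(gap k) natrD natrD natrM.
  apply: le_trans (ler_normD _ _) _; rewrite (normrM (m%:R - _)) normr_nat.
  have h : `|m%:R - (d k)%:R : R| <= (d k)%:R.
    rewrite ler_norml lerBlDr -natrD addnn -mul2n ler_nat -ltnS m2 andbT.
    by rewrite lerBrDr addNr.
  have := normr_rat_seq k; have := ler_wpM2r (ler0n R (gap k)) h.
  have := ler0n R (radius k).
  rewrite [(d k)%:R * _]mulrC; lra.
have large : (radius l)%:R + 1 <= `|ratr (rat_seq l) + (n%:R - (d l)%:R) * (gap l)%:R : R|.
  have gapE : (gap l)%:R = (radius l)%:R + 2 * (rat_bound l)%:R + 1 :> R.
    by rewrite /gap natrD natrD natrM.
  set P := _ * _.
  have h : (radius l)%:R + 2 * (rat_bound l)%:R + 1 <= `|P|.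
    by rewrite -gapE normrM normr_nat ler_peMl// normr_natB_ge1.
  have h' : `|P| <= `|ratr (rat_seq l) + P| + `|ratr (rat_seq l)|.
    by rewrite -{1}[P](addKr (ratr (rat_seq l))) addrC ler_normB.
  have := normr_rat_seq l; have := ler0n R (rat_bound l); move: h h'; lra.
rewrite distrC; apply: le_trans (lerB_dist _ _); move: small large; lra.
Qed.

(** The index set is countable, and infinite because [0 < d k] puts [(k, 0)] in it for every [k]. *)
Lemma node_enumeration : exists phi : nat -> nat * nat,
  [/\ injective phi, forall n, node_index (phi n) &
      forall x, node_index x -> exists n, phi n = x].
Proof.
have inf : infinite_set node_index.
  move=> /(finite_image fst) fin; apply: infinite_nat.
  apply: sub_finite_set fin => k _; exists (k, 0%N) => //.
  by rewrite /node_index /= eq_sym -lt0n.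
have /card_esym/card_set_bijP[phi [fphi iphi sphi]] := eq_card_nat (countableP node_index) inf.
exists phi; split.
- by move=> m n; apply: iphi; rewrite inE.
- by move=> n; exact: fphi.
- by move=> x /sphi[n _ <-]; exists n.
Qed.

(** A stage is finite, so an initial segment of the enumeration exhausts it. The same [N] serves the
    sums of functions and of coefficients. *)
Lemma sum_node_index (phi : nat -> nat * nat) k :
  injective phi -> (forall n, node_index (phi n)) ->
  (forall x, node_index x -> exists n, phi n = x) ->
  exists N, forall (V : nmodType) (H : nat -> V),
    \sum_(i < N | (phi i).1 == k) H (phi i).2 =
    \sum_(n < (2 * d k).+1 | n != d k :> nat) H n.
Proof.
move=> iphi fphi sphi.
have /choice[idx idxP] : forall n, exists i, node_index (k, n) -> phi i = (k, n).
  move=> n; have [I|nI] := pselect (node_index (k, n)); last by exists 0%N.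
  by have [i <-] := sphi _ I; exists i.
pose N := (\max_(n < (2 * d k).+1) idx n).+1.
exists N => V H.
transitivity (\sum_(i < N | (phi i).1 == k)
    \sum_(n < (2 * d k).+1 | (n != d k :> nat) && (n == (phi i).2 :> nat)) H n).
  apply: eq_bigr => i /eqP ik; have := fphi i; rewrite /node_index /= ik => /andP[i2 id].
  rewrite (big_pred1 (Ordinal i2))// => n /=; rewrite -[RHS]val_eqE/=.
  by rewrite andbC; case: eqP => // ->; rewrite id.
rewrite (exchange_big_dep (fun n : 'I__ => n != d k :> nat))/=; last first.
  by move=> i n _ /andP[].
apply: eq_bigr => n nd.
have nI : node_index (k, nat_of_ord n) by rewrite /node_index /= ltn_ord.
have iN : (idx n < N)%N by rewrite ltnS (leq_bigmax n).
rewrite (big_pred1 (Ordinal iN))// => i /=; rewrite -[RHS]val_eqE/= nd/=.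
apply/idP/idP => [/andP[/eqP i1 /eqP i2]|/eqP ->]; last by rewrite idxP//= !eqxx.
apply/eqP/iphi; rewrite idxP// i2 -i1; exact: surjective_pairing.
Qed.

End Schedule.

(** * Quasi-frames of real functions *)

Section RealQuasiFrame.
Context {R : realType}.
Implicit Types (f g h : R -> R) (k n N : nat) (c : nat -> R).

Local Notation SI := square_integrable.
Local Notation e := (@unit_itv R).

(** * Approximation with arbitrarily small l_q coefficients *)

Section Approximable.
Variables (u : nat -> R -> R) (q : R).
Hypothesis uL : forall n, SI (u n).
Hypothesis q0 : 0 < q.

(** The coefficients get arbitrarily small in l_q, whatever the norm of [f]. In this form the
    property passes to sums, multiples and limits, hence to closed spans. *)
Definition approximable f := forall eps, 0 < eps -> exists N c,
  nrm (f - \sum_(n < N) c n *: u n) <= eps /\ \sum_(n < N) `|c n| `^ q <= eps.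

Let combL N c : SI (\sum_(n < N) c n *: u n).
Proof. by apply: square_integrable_sum => n _; exact: square_integrableZ. Qed.

Lemma pad_combination N M c : (N <= M)%N -> exists c',
  \sum_(n < M) c' n *: u n = \sum_(n < N) c n *: u n /\
  \sum_(n < M) `|c' n| `^ q = \sum_(n < N) `|c n| `^ q.
Proof.
move=> NM; exists (fun n => if (n < N)%N then c n else 0); split.
  rewrite (big_ord_widen M (fun n => c n *: u n))// [RHS]big_mkcond/=.
  by apply: eq_bigr => n _; case: ifP => // _; rewrite scale0r.
rewrite (big_ord_widen M (fun n => `|c n| `^ q))// [RHS]big_mkcond/=.
by apply: eq_bigr => n _; case: ifP => // _; rewrite normr0 powR0// gt_eqF.
Qed.

(** The absolute value of [x + y] is at most twice the larger of the two. *)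
Lemma powR_normD_le (x y : R) : `|x + y| `^ q <= 2 `^ q * (`|x| `^ q + `|y| `^ q).
Proof.
wlog xy : x y / `|x| <= `|y|.
  by move=> H; have [/H//|/ltW/H] := leP `|x| `|y|; rewrite addrC [X in _ * X]addrC.
apply: (@le_trans _ _ ((2 * `|y|) `^ q)).
  rewrite ge0_ler_powR ?nnegrE ?mulr_ge0 ?(ltW q0)//.
  by apply: le_trans (ler_normD _ _) _; move: xy; lra.
by rewrite powRM// ler_wpM2l ?powR_ge0// lerDr powR_ge0.
Qed.

Lemma approximableD f g : SI f -> SI g ->
  approximable f -> approximable g -> approximable (f + g).
Proof.
move=> fL gL fA gA eps eps0.
have K0 : 0 < 2 `^ q by apply: powR_gt0.
have K1 : 1 <= 2 `^ q.
  by have := ler_powR (_ : 1 <= 2) (ltW q0); rewrite powRr0 ler1n; exact.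
pose eta := eps / (2 * 2 `^ q).
have eta0 : 0 < eta by rewrite divr_gt0// mulr_gt0.
have etaE : 2 `^ q * (eta + eta) = eps by rewrite /eta; field; rewrite gt_eqF.
have eta2 : eta + eta <= eps by rewrite -etaE ler_peMl// addr_ge0// ltW.
have [N1 [c1 [h1 s1]]] := fA _ eta0; have [N2 [c2 [h2 s2]]] := gA _ eta0.
have [c1' [e1 e1']] := pad_combination c1 (leq_maxl N1 N2).
have [c2' [e2 e2']] := pad_combination c2 (leq_maxr N1 N2).
rewrite -e1 in h1; rewrite -e1' in s1; rewrite -e2 in h2; rewrite -e2' in s2.
exists (maxn N1 N2), (fun n => c1' n + c2' n); split.
  under eq_bigr do rewrite scalerDl.
  rewrite big_split/= opprD addrACA.
  apply: le_trans (nrmD (square_integrableB fL (combL _ _))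
    (square_integrableB gL (combL _ _))) _.
  by apply: le_trans (lerD h1 h2) _.
apply: (@le_trans _ _ (\sum_(n < maxn N1 N2)
    2 `^ q * (`|c1' n| `^ q + `|c2' n| `^ q))).
  by apply: ler_sum => n _; exact: powR_normD_le.
rewrite -mulr_sumr big_split/= -[leRHS]etaE ler_wpM2l ?powR_ge0//.
exact: lerD.
Qed.

Lemma approximableZ (a : R) f : SI f -> approximable f -> approximable (a *: f).
Proof.
move=> fL fA eps eps0.
pose K := 1 + `|a| + `|a| `^ q.
have aq0 := powR_ge0 `|a| q.
have K0 : 0 < K by rewrite /K -addrA ltr_pwDl// addr_ge0.
have [N [c [h s]]] := fA _ (divr_gt0 eps0 K0).
exists N, (fun n => a * c n); split.
  under eq_bigr do rewrite -scalerA.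
  rewrite -scaler_sumr -scalerBr nrmZ; last exact: (square_integrableB fL (combL _ _)).
  apply: le_trans (ler_wpM2l (normr_ge0 a) h) _.
  rewrite mulrCA ler_piMr ?(ltW eps0)// ler_pdivrMr// mul1r.
  by rewrite /K; have := normr_ge0 a; lra.
under eq_bigr do rewrite normrM powRM//.
rewrite -mulr_sumr; apply: le_trans (ler_wpM2l aq0 s) _.
rewrite mulrCA ler_piMr ?(ltW eps0)// ler_pdivrMr// mul1r.
by rewrite /K; have := normr_ge0 a; lra.
Qed.

Lemma approximable_closed f : SI f ->
  (forall eps, 0 < eps -> exists g, [/\ SI g, approximable g & nrm (f - g) <= eps]) ->
  approximable f.
Proof.
move=> fL fA eps eps0.
have eps2 : 0 < eps / 2 by rewrite divr_gt0.
have [g [gL gA fg]] := fA _ eps2; have [N [c [h s]]] := gA _ eps2.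
exists N, c; split; last by apply: le_trans s _; lra.
apply: le_trans (nrm_dist_le fL gL (combL N c)) _.
by apply: le_trans (lerD fg h) _; lra.
Qed.

End Approximable.

Theorem real_quasi_frame : exists (lam : nat -> R) (g : R -> R),
  [/\ forall m n, m != n -> 1 <= `|lam m - lam n|, SI g,
      forall N f, SI f -> \sum_(n < N) ip f (shift (lam n) g) ^+ 2 <= ip f f &
      forall q, 2 < q -> forall f, SI f ->
        approximable (fun n => shift (lam n) g) q f].
Proof.
(* Summability makes the product of the [B k] converge, and the limit 0 brings every [q > 2] within
   reach of the late stages. *)
pose del k : R := 2 ^- k.+1.
have del0 k : 0 < del k by rewrite invr_gt0 exprn_gt0.
(* The degrees [d] and the coefficients come first for all stages, since the gaps are defined from
   [d]; only then are the operators taken, with [gp k] for [N]. *)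
have /choice[dC dCP] : forall k, exists dC : nat * (nat -> R),
  [/\ (0 < dC.1)%N, dC.2 dC.1 = 1,
    forall q, 2 + del k <= q ->
      \sum_(n < (2 * dC.1).+1 | n != dC.1 :> nat) `|dC.2 n| `^ q <= del k &
    forall N, (0 < N)%N -> exists A B, [/\ even_op A /\ even_op B,
      (forall f, SI f -> nrm (B f) <= nrm f), nrm (B e - e) <= del k /\
      nrm (A (B e)) <= del k,
      (forall f, A f = \sum_(n < (2 * dC.1).+1)
        dC.2 n *: shift ((n%:R - dC.1%:R) * N%:R) f) &
      forall Y, closed_invariant Y -> forall y, SI y -> Y (B y) -> Y y]].
  move=> k; have [d [C dCP]] := @approximation_step R _ (del0 k).
  by exists (d, C).
pose d k := (dC k).1; pose C k := (dC k).2.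
have d0 k : (0 < d k)%N by case: (dCP k).
have C1 k : C k (d k) = 1 by case: (dCP k).
have Cq k q : 2 + del k <= q ->
    \sum_(n < (2 * d k).+1 | n != d k :> nat) `|C k n| `^ q <= del k.
  by case: (dCP k) => _ _ + _; exact.
pose gp := @gap R d.
have gp0 k : (0 < gp k)%N by rewrite /gp /gap addn1.
have /choice[AB ABP] : forall k, exists AB : ((R -> R) -> R -> R) * ((R -> R) -> R -> R),
    [/\ even_op AB.1 /\ even_op AB.2,
      (forall f, SI f -> nrm (AB.2 f) <= nrm f), nrm (AB.2 e - e) <= del k /\
      nrm (AB.1 (AB.2 e)) <= del k,
      (forall f, AB.1 f = \sum_(n < (2 * d k).+1)
        C k n *: shift ((n%:R - (d k)%:R) * (gp k)%:R) f) &
      forall Y, closed_invariant Y -> forall y, SI y -> Y (AB.2 y) -> Y y].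
  move=> k; case: (dCP k) => _ _ _ /(_ (gp k) (gp0 k))[A [B H]].
  by exists (A, B).
pose A k := (AB k).1; pose B k := (AB k).2.
have opA k : even_op (A k) by case: (ABP k) => -[].
have opB k : even_op (B k) by case: (ABP k) => -[].
have Bc k : forall f, SI f -> nrm (B k f) <= nrm f by case: (ABP k).
have Be k : nrm (B k e - e) <= 2 ^- k.+1 by case: (ABP k) => _ _ [].
have ABe k : nrm (A k (B k e)) <= del k by case: (ABP k) => _ _ [].
have AE k : forall f, A k f = \sum_(n < (2 * d k).+1)
    C k n *: shift ((n%:R - (d k)%:R) * (gp k)%:R) f by case: (ABP k).
have BY k : forall Y, closed_invariant Y -> forall y, SI y -> Y (B k y) -> Y y.
  by case: (ABP k).
clear ABP dCP.
have GL := partial_product_SI opB.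
have [gs [gsL gsG gsB gsn]] := infinite_product opB Bc Be.
have [phi [iphi fphi sphi]] := node_enumeration d0.
pose lam n : R := node d (phi n); pose g := gs 0%N.
have gL : SI g by exact: gsL.
have uL n : SI (shift (lam n) g) by exact: square_integrable_shift.
have lam1 m n : m != n -> 1 <= `|lam m - lam n|.
  by move=> mn; apply: node_separated => //; rewrite (inj_eq iphi).
(* This holds for the partial products with more than [k] factors, and [A k] is bounded. *)
have Ag k : nrm (A k g) <= del k.
  apply/ler_addgt0Pr => eps eps0.
  have [M M0 AM] := even_op_bounded (opA k).
  have M1 : 0 < M + 1 by rewrite ltr_wpDl.
  have [n0 n0P] := gsn _ (divr_gt0 eps0 M1) 0%N.
  pose n := maxn n0 k.+1; have AL := even_op_square_integrable (opA k).
  have -> : A k g = A k (partial_product B 0 n) + A k (g - partial_product B 0 n).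
    by rewrite -(even_opD (opA k)) subrKC.
  have dL := square_integrableB gL (GL 0%N n).
  apply: le_trans (nrmD _ _) _; try exact: AL.
  apply: lerD.
    apply: (partial_product_small opB Bc (opA k) (ABe k)) => //.
    by rewrite add0n /n leq_maxr.
  apply: le_trans (AM _ dL) _.
  apply: (@le_trans _ _ (M * (eps / (M + 1)))).
    by rewrite ler_wpM2l// n0P// leq_maxl.
  by rewrite mulrCA ler_piMr ?(ltW eps0)// ler_pdivrMr// mul1r lerDl.
exists lam, g; split => //.
- move=> N f fL.
  have cv n : ip f (shift (lam n) (partial_product B 0 j)) @[j --> \oo] -->
      ip f (shift (lam n) g).
    apply/cvgrPdist_le => eps eps0.
    have F1 : 0 < nrm f + 1 by rewrite ltr_wpDl ?nrm_ge0.
    have [n0 n0P] := gsn _ (divr_gt0 eps0 F1) 0%N.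
    exists n0 => // j /= n0j.
    have GjL := GL 0%N j; have dL := square_integrableB gL GjL.
    rewrite -ipNr// -?ipDr//; try exact: square_integrable_shift;
      last by apply: square_integrableN; exact: square_integrable_shift.
    rewrite -[X in ip f X]/(shift (lam n) (g - partial_product B 0 j)).
    apply: le_trans (normr_ip_le fL _) _; first exact: square_integrable_shift.
    rewrite nrm_shift//.
    apply: (@le_trans _ _ (nrm f * (eps / (nrm f + 1)))).
      by rewrite ler_wpM2l ?nrm_ge0// n0P.
    by rewrite mulrCA ler_piMr ?(ltW eps0)// ler_pdivrMr// mul1r lerDl.
  have cvS : (\sum_(n < N) ip f (shift (lam n) (partial_product B 0 j)) ^+ 2)
      @[j --> \oo] --> \sum_(n < N) ip f (shift (lam n) g) ^+ 2.
    apply: cvg_big; first exact: add_continuous.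
    move=> n _.
    apply: (@cvg_comp _ _ _ (fun j => ip f (shift (lam n) (partial_product B 0 j)))
      (fun y : R => y ^+ 2) _ _ _ (cv n)); exact: exprn_continuous.
  have <- := cvg_lim (@Rhausdorff R) cvS.
  apply: limr_le; first by apply/cvg_ex; eexists; exact: cvS.
  apply: nearW => j; exact: (partial_product_bessel opB Bc).
move=> q q2 f fL.
have q0 : 0 < q by lra.
have base k0 eps : 0 < eps -> exists2 k1, (k0 <= k1)%N & forall k, (k1 <= k)%N -> del k <= eps.
  have half : 0 <= (2^-1 : R) < 1 by apply/andP; split; lra.
  move=> eps0; have [n hn] := exprn_small half eps0.
  exists (maxn k0 n); first exact: leq_maxl.
  move=> k; rewrite geq_max => /andP[_ nk]; apply: le_trans hn.
  rewrite /del exprVn lef_pV2 ?posrE ?exprn_gt0// ler_weXn2l ?ler1n//.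
  exact: leq_trans nk (leqnSn k).
(* A stage [k] centred at [r] is taken so late that [del k <= eps] and [2 + del k <= q]. In the
   shift of [A k g] by [r], of norm at most [del k], the central term is [shift (ratr r) g] itself,
   since [C k (d k) = 1]. *)
have App r : approximable (fun n => shift (lam n) g) q (shift (ratr r) g).
  move=> eps eps0.
  have [k1 _ k1P] := base 0%N eps eps0.
  have q20 : 0 < q - 2 by rewrite subr_gt0.
  have [k2 k12 k2P] := base k1 _ q20.
  have [k k2k kr] := rat_seq_cofinal r k2.
  have dk_eps : del k <= eps by apply: k1P; exact: leq_trans k12 k2k.
  have dk_q : 2 + del k <= q by have := k2P _ k2k; lra.
  have [N NH] := sum_node_index k iphi fphi sphi.
  exists N, (fun i => if (phi i).1 == k then - C k (phi i).2 else 0); split.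
    have -> : \sum_(i < N) (if (phi i).1 == k then - C k (phi i).2 else 0) *:
        shift (lam i) g = \sum_(n < (2 * d k).+1 | n != d k :> nat)
          - C k n *: shift (ratr r + (n%:R - (d k)%:R) * (gp k)%:R) g.
      rewrite -(NH _ (fun n => - C k n *:
        shift (ratr r + (n%:R - (d k)%:R) * (gp k)%:R) g)) [RHS]big_mkcond/=.
      apply: eq_bigr => i _; case: eqP => [ik|_]; last by rewrite scale0r.
      by rewrite /lam /node ik kr.
    have -> : shift (ratr r) g - \sum_(n < (2 * d k).+1 | n != d k :> nat)
        - C k n *: shift (ratr r + (n%:R - (d k)%:R) * (gp k)%:R) g =
        shift (ratr r) (A k g).
      have dk : (d k < (2 * d k).+1)%N by lia.
      rewrite AE [in RHS](bigD1 (Ordinal dk))//= [in RHS]subrr [in RHS]mul0r.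
      rewrite [in RHS]shift0 C1 [in RHS]scale1r [in RHS]shiftD.
      congr (_ + _); rewrite shift_sum -sumrN.
      apply: eq_big => [n|n _]; first by rewrite -(inj_eq val_inj).
      by rewrite scaleNr opprK shiftZ shift_shift.
    rewrite nrm_shift; last exact: even_op_square_integrable.
    exact: le_trans (Ag k) dk_eps.
  apply: le_trans dk_eps; apply: le_trans (Cq k q dk_q).
  rewrite -(NH _ (fun n => `|C k n| `^ q)) [leRHS]big_mkcond/=.
  apply: ler_sum => i _; case: eqP => _; first by rewrite normrN.
  by rewrite normr0 powR0// gt_eqF.
(* Asking for all rational translates at once makes [Y] invariant under them. *)
pose Y := [set f | SI f /\ forall r : rat,
  approximable (fun n => shift (lam n) g) q (shift (ratr r) f)].
have sL a h : SI h -> SI (shift a h) by exact: square_integrable_shift.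
have Yinv : rat_closed_invariant Y.
  split.
  - by move=> h [].
  - move=> h1 h2 [h1L A1] [h2L A2]; split; first exact: square_integrableD.
    by move=> r; apply: (approximableD uL q0 (sL _ _ h1L) (sL _ _ h2L)).
  - move=> a h [hL Ah]; split; first exact: square_integrableZ.
    by move=> r; rewrite shiftZ; apply: (approximableZ uL _ (sL _ _ hL)).
  - move=> r h [hL Ah]; split; first exact: sL.
    by move=> r'; rewrite shift_shift -raddfD; exact: Ah.
  - move=> h hL hY; split=> // r; apply: (approximable_closed uL (sL _ _ hL)) => eps eps0.
    have [h' [h'L Ah'] hh'] := hY _ eps0.
    exists (shift (ratr r) h'); split => //; first exact: sL.
    rewrite -[X in nrm X]/(shift (ratr r) (h - h')) nrm_shift//.
    exact: square_integrableB.
(* From [gs 0 = g] on, [gs k = B k (gs k.+1)] in [Y] puts [gs k.+1] in [Y], by the inversion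
   property of [B k]. *)
have Yg k : Y (gs k).
  elim: k => [|k IH]; first by split.
  apply: (BY k _ (rat_closed_invariantW Yinv)) => //.
  by rewrite -gsB.
(* The tails [gs k] tend to [e] as [k] grows. *)
have Ye : Y e.
  have [_ _ _ _] := Yinv; apply; first exact: square_integrable_unit_itv.
  move=> eps eps0; have [k _ kP] := base 0%N eps eps0.
  exists (gs k.+1) => //; rewrite nrm_distC//; last exact: square_integrable_unit_itv.
  apply: le_trans (gsG k.+1 0%N) _; rewrite addn0.
  exact: kP.
have [_ /(_ 0)] := generated_all Yinv Ye fL.
by rewrite rmorph0 shift0.
Qed.

End RealQuasiFrame.

(** * From real to complex functions *)

Section ComplexL2.
Context {R : realType}.
Implicit Types (f : R -> R[i]^o) (g h : R -> R).

Local Notation SI := square_integrable.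
Local Notation mu := (@lebesgue_measure R).

Definition re_part f : R -> R := fun t => complex.Re (f t).
Definition im_part f : R -> R := fun t => complex.Im (f t).
Definition of_real h : R -> R[i]^o := fun t => real_complex R (h t).

Lemma sqr_normc (z : R[i]) :
  Normc.normc z ^+ 2 = complex.Re z ^+ 2 + complex.Im z ^+ 2.
Proof. by case: z => x y /=; rewrite sqr_sqrtr// addr_ge0// sqr_ge0. Qed.

Lemma L2P f : L2 f <-> SI (re_part f) /\ SI (im_part f).
Proof.
pose nf : R -> R := fun t => Normc.normc (f t).
have nfE t : nf t ^+ 2 = re_part f t ^+ 2 + im_part f t ^+ 2 by exact: sqr_normc.
have mnf : measurable_fun [set: R] (re_part f) ->
    measurable_fun [set: R] (im_part f) -> measurable_fun [set: R] nf.
  move=> mr mi.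
  have -> : nf = Num.sqrt \o (fun t => re_part f t ^+ 2 + im_part f t ^+ 2).
    by apply/funext => t /=; rewrite -nfE sqrtr_sqr ger0_norm// /nf;
      case: (f t) => x y; exact: sqrtr_ge0.
  have ms : measurable_fun [set: R] (@Num.sqrt R).
    by apply: continuous_measurable_fun; exact: sqrt_continuous.
  apply: (measurableT_comp ms).
  by apply: measurable_funD; exact: measurable_funX.
split.
  move=> [mr mi fn]; have nL : SI nf.
    by apply/andP; split; rewrite inE//; exact: mnf.
  have /square_integrableP[_ ni] := nL.
  split; apply/square_integrableP; split => //; apply: (le_integrable measurableT _ _ ni).
  - by apply/measurable_EFinP; exact: measurable_funX.
  - move=> t _ /=; rewrite lee_fin !ger0_norm ?sqr_ge0// nfE lerDl; exact: sqr_ge0.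
  - by apply/measurable_EFinP; exact: measurable_funX.
  - move=> t _ /=; rewrite lee_fin !ger0_norm ?sqr_ge0// nfE lerDr; exact: sqr_ge0.
move=> [/square_integrableP[mr ri] /square_integrableP[mi ii]]; split => //.
have /andP[_] : SI nf; last by rewrite inE.
apply/square_integrableP; split; first exact: mnf.
apply: eq_integrable (integrableD measurableT ri ii) => // t _.
by rewrite /= nfE.
Qed.

Lemma L2_of_real h : SI h -> L2 (of_real h).
Proof. by move=> hL; apply/L2P; split => //; exact: square_integrable0. Qed.

(** Pairing with a real function acts separately on real and imaginary parts, which reduces the
    Bessel inequality to real functions. *)
Lemma L2dot_of_real f h :
  L2dot f (of_real h) = (ip (re_part f) h +i* ip (im_part f) h)%C.
Proof.
rewrite /L2dot /complex_integral; congr (_ +i* _)%C; apply: eq_Rintegral => t _;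
  rewrite /re_part /im_part /of_real; case: (f t) => x y /=;
  by rewrite oppr0 ?mulr0 ?subr0 ?add0r.
Qed.

Lemma sqr_dot_norm f : L2 f ->
  dot_norm (@L2dot R) f ^+ 2 = ip (re_part f) (re_part f) + ip (im_part f) (im_part f).
Proof.
move=> /L2P[rL iL]; rewrite /dot_norm.
have -> : complex.Re (L2dot f f) = ip (re_part f) (re_part f) + ip (im_part f) (im_part f).
  rewrite /ip -RintegralD//; try exact: square_integrableM.
  apply: eq_Rintegral => t _; rewrite /re_part /im_part.
  by case: (f t) => x y /=; rewrite mulrN opprK.
by rewrite sqr_sqrtr// addr_ge0// ip_ge0.
Qed.

Lemma dot_norm_ge0 f : 0 <= dot_norm (@L2dot R) f.
Proof. exact: sqrtr_ge0. Qed.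

Lemma dot_norm_le f : L2 f ->
  dot_norm (@L2dot R) f <= nrm (re_part f) + nrm (im_part f).
Proof.
move=> fL; rewrite -(@ler_pXn2r _ 2)// ?nnegrE ?addr_ge0 ?nrm_ge0 ?dot_norm_ge0//.
rewrite sqr_dot_norm// sqrrD !sqr_nrm.
by have := mulr_ge0 (nrm_ge0 (re_part f)) (nrm_ge0 (im_part f)); lra.
Qed.

Lemma re_part_sub_combination f (N : nat) (c : 'I_N -> R[i]) (u : nat -> R -> R) :
  re_part (f - \sum_(n < N) c n *: of_real (u n)) =
    re_part f - \sum_(n < N) complex.Re (c n) *: u n /\
  im_part (f - \sum_(n < N) c n *: of_real (u n)) =
    im_part f - \sum_(n < N) complex.Im (c n) *: u n.
Proof.
have reD (f1 f2 : R -> R[i]^o) : re_part (f1 + f2) = re_part f1 + re_part f2.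
  by apply/funext => t; rewrite /re_part !fctE; case: (f1 t); case: (f2 t).
have imD (f1 f2 : R -> R[i]^o) : im_part (f1 + f2) = im_part f1 + im_part f2.
  by apply/funext => t; rewrite /im_part !fctE; case: (f1 t); case: (f2 t).
have reN (f1 : R -> R[i]^o) : re_part (- f1) = - re_part f1.
  by apply/funext => t; rewrite /re_part !fctE; case: (f1 t).
have imN (f1 : R -> R[i]^o) : im_part (- f1) = - im_part f1.
  by apply/funext => t; rewrite /im_part !fctE; case: (f1 t).
split.
  rewrite reD reN (big_morph re_part reD (_ : re_part 0 = 0))//.
  congr (_ - _); apply: eq_bigr => n _; apply/funext => t.
  rewrite /re_part /of_real !fctE /GRing.scale/=.
  by case: (c n) => x y /=; rewrite mulr0 subr0.
rewrite imD imN (big_morph im_part imD (_ : im_part 0 = 0))//.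
congr (_ - _); apply: eq_bigr => n _; apply/funext => t.
rewrite /im_part /of_real !fctE /GRing.scale/=.
by case: (c n) => x y /=; rewrite mulr0 add0r.
Qed.

Lemma L2_sub_combination f (N : nat) (c : 'I_N -> R[i]) (u : nat -> R -> R) :
  L2 f -> (forall n, SI (u n)) -> L2 (f - \sum_(n < N) c n *: of_real (u n)).
Proof.
move=> /L2P[rL iL] uL; apply/L2P; have [-> ->] := re_part_sub_combination f c u.
by split; apply: square_integrableB => //; apply: square_integrable_sum => n _;
  exact: square_integrableZ.
Qed.

Lemma normc_powR_le (q : R) (z : R[i]) : 0 < q -> Normc.normc z `^ q <=
  2 `^ q * (`|complex.Re z| `^ q + `|complex.Im z| `^ q).
Proof.
move=> q0; have := powR_normD_le q0 `|complex.Re z| `|complex.Im z|.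
rewrite !normr_id; apply: le_trans.
rewrite (ger0_norm (addr_ge0 (normr_ge0 _) (normr_ge0 _))).
have n0 : 0 <= Normc.normc z by case: (z) => x y; exact: sqrtr_ge0.
have s0 : 0 <= `|complex.Re z| + `|complex.Im z| by exact: addr_ge0.
rewrite ge0_ler_powR ?nnegrE ?(ltW q0)// -(@ler_pXn2r _ 2)// ?nnegrE//.
rewrite sqr_normc sqrrD !real_normK ?num_real//.
have := mulr_ge0 (normr_ge0 (complex.Re z)) (normr_ge0 (complex.Im z)); lra.
Qed.

Lemma QF_approximation_of_real (u : nat -> R -> R) : (forall n, SI (u n)) ->
  (forall q, 2 < q -> forall h, SI h -> approximable u q h) ->
  QF_approximation L2 (@L2dot R) (fun n => of_real (u n)).
Proof.
move=> uL uA q q2; exists 1 => f fL eps eps0; rewrite mul1r.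
have q0 : 0 < q by lra.
have [rL iL] := (L2P f).1 fL.
set D := dot_norm _ f; have D0 : 0 <= D by exact: dot_norm_ge0.
(* For [f] of norm 0 the bound admits only zero coefficients, and the empty combination serves. *)
have [DE|Dn0] := eqVneq D 0.
  exists 0%N, (fun _ => 0); rewrite big_ord0 subr0 -/D DE; split => //.
  by rewrite /lq_norm big_ord0 powR0// invr_eq0 gt_eqF.
have Dp : 0 < D by rewrite lt_neqAle eq_sym Dn0.
have Dq : 0 < D `^ q by exact: powR_gt0.
have K0 : 0 < 2 `^ q :> R by exact: powR_gt0.
(* The first bound keeps the sum of two errors below [eps]; the second brings the l_q norm of the
   complex coefficients down to at most [D], which gives the constant 1 for every [q]. *)
pose eta := Num.min (eps / 3) (D `^ q / (2 * 2 `^ q)).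
have eta0 : 0 < eta by rewrite lt_min !divr_gt0// mulr_gt0.
have eta1 : eta <= eps / 3 by rewrite ge_min lexx.
have eta2 : 2 `^ q * (eta + eta) <= D `^ q.
  have -> : D `^ q = 2 `^ q * (D `^ q / (2 * 2 `^ q) + D `^ q / (2 * 2 `^ q)).
    by field; rewrite gt_eqF.
  by rewrite ler_pM2l// lerD// ge_min lexx orbT.
have [N1 [c1 [h1 s1]]] := uA q q2 _ rL _ eta0.
have [N2 [c2 [h2 s2]]] := uA q q2 _ iL _ eta0.
have [c1' [e1 e1']] := pad_combination u q0 c1 (leq_maxl N1 N2).
have [c2' [e2 e2']] := pad_combination u q0 c2 (leq_maxr N1 N2).
rewrite -e1 in h1; rewrite -e1' in s1; rewrite -e2 in h2; rewrite -e2' in s2.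
exists (maxn N1 N2), (fun n => (c1' n +i* c2' n)%C); split.
  apply: le_lt_trans (dot_norm_le (L2_sub_combination _ fL uL)) _.
  have [-> ->] := re_part_sub_combination f (fun n : 'I_(maxn N1 N2) => (c1' n +i* c2' n)%C) u.
  by apply: le_lt_trans (lerD h1 h2) _; lra.
have -> : D = (D `^ q) `^ q^-1 by rewrite -powRrM mulfV ?gt_eqF// powRr1.
rewrite /lq_norm ge0_ler_powR ?nnegrE ?invr_ge0 ?(ltW q0) ?powR_ge0//.
  by apply: sumr_ge0 => n _; exact: powR_ge0.
apply: le_trans eta2; apply: (@le_trans _ _ (\sum_(n < maxn N1 N2)
    2 `^ q * (`|c1' n| `^ q + `|c2' n| `^ q))).
  by apply: ler_sum => n _; exact: (normc_powR_le (c1' n +i* c2' n)%C q0).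
by rewrite -mulr_sumr big_split/= ler_wpM2l ?powR_ge0// lerD.
Qed.

(** The inequalities for the real and imaginary parts add up. *)
Lemma Bessel_of_real (u : nat -> R -> R) : (forall n, SI (u n)) ->
  (forall N h, SI h -> \sum_(n < N) ip h (u n) ^+ 2 <= ip h h) ->
  Bessel L2 (@L2dot R) (fun n => of_real (u n)).
Proof.
move=> uL uB; exists 1 => f fL; rewrite mul1r.
have [rL iL] := (L2P f).1 fL.
have -> : (dot_norm (@L2dot R) f)%:E = sqrte ((dot_norm (@L2dot R) f ^+ 2)%:E).
  by rewrite /sqrte sqrtr_sqr ger0_norm// dot_norm_ge0.
rewrite lee_sqrt ?lee_fin ?sqr_ge0//.
apply: lime_le; first by apply: is_cvg_nneseries => n _ _; rewrite lee_fin sqr_ge0.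
apply: nearW => N; rewrite sumEFin lee_fin sqr_dot_norm// big_mkord.
apply: le_trans (lerD (uB N _ rL) (uB N _ iL)).
rewrite -big_split; apply: ler_sum => n _.
by rewrite (L2dot_of_real f (u n)) sqr_normc.
Qed.

End ComplexL2.

Theorem theorem1 (R : realType) :
  exists (lambda : nat -> R) (g : R -> R[i]^o),
    [/\ injective lambda,
        uniformly_discrete (range lambda),
        L2 g &
        QF_system L2 L2dot (fun n => translate (lambda n) g)].
Proof.
have [lam [g [lam1 gL gB gA]]] := @real_quasi_frame R.
have uL n : square_integrable (shift (lam n) g) by exact: square_integrable_shift.
exists lam, (of_real g); split.
- move=> m n mn; apply/eqP; apply: contraPT mn => /lam1.
  by move=> + lamE; rewrite lamE subrr normr0 ler10.
- apply: (@lt_le_trans _ _ 1%E) => //; apply: le_ereal_inf_tmp.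
  move=> _ [_ [_ [[m _ <-] [n _ <-] mn ->]]]; rewrite lee_fin lam1//.
  by apply: contra_neq mn => ->.
- exact: L2_of_real.
split.
- by move=> n; exact: (L2_of_real (uL n)).
- exact: (QF_approximation_of_real uL gA).
- exact: (Bessel_of_real uL gB).
Qed.
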